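(* If $\frac12<p\le 1$, then for the $p$-percentile rule $V_n\to q_p$ almost surely as $n\to\infty$, where $V_n=Q_n/L_n^2=A_n/L_n$ and $q_p=\frac12 p^2/(2p-1)$. Furthermore, $E(V_n)\to q_p$ as $n\to\infty$.
   Context: $X_1,X_2,\ldots$ are i.i.d. real random variables with a continuous distribution. Smaller values are better; $R_i^n=\sum_{j=1}^n I\{X_j\le X_i\}$ is the rank of $X_i$ among $X_1,\ldots,X_n$. For fixed $0<p\le1$ the $p$-percentile rule retains items as follows: $S_1=\{1\}$, and for $n\ge 2$, $X_n$ is retained (i.e. $S_n=S_{n-1}\cup\{n\}$) if and only if $R_n^n\le\lceil pL_{n-1}\rceil$, otherwise $S_n=S_{n-1}$; here $S_n$ is the set of indices of retained items among the first $n$ and $L_n=|S_n|$. $Q_n=\sum_{i\in S_n}R_i^n$ is the sum of the ranks of the retained items and $A_n=Q_n/L_n$ is their average rank. *)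

(* Defs.v *)
From HB Require Import structures.
From mathcomp Require Import all_boot all_order all_algebra finmap.
From mathcomp Require Import all_classical all_reals all_analysis.

Set Implicit Arguments.
Unset Strict Implicit.
Unset Printing Implicit Defensive.

Import Order.TTheory GRing.Theory Num.Theory.
Import numFieldNormedType.Exports.

Local Open Scope classical_set_scope.
Local Open Scope ring_scope.

Section IID.
Context d (T : measurableType d) (R : realType) (P : probability T R).

Definition mutually_independent (X : nat -> {RV P >-> R}) : Prop :=
  forall (J : {fset nat}) (A : nat -> set R),
    (forall j, j \in J -> measurable (A j)) ->
    P (\bigcap_(j in [set` J]) (X j @^-1` A j)) =
    (\prod_(j <- J) P (X j @^-1` A j))%E.

Definition identically_distributed (X : nat -> {RV P >-> R}) : Prop :=
  forall (n : nat) (A : set R), measurable A ->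
    distribution P (X n) A = distribution P (X 0%N) A.

Definition continuous_distribution (Y : {RV P >-> R}) : Prop :=
  continuous (cdf Y).

End IID.

(* Items are numbered from 0: [x i] is the value of the (i+1)-st item X_{i+1}.
   The parameter [n] counts the items seen so far, so these are the items
   0, ..., n-1. *)
Section PercentileRule.
Context (R : realType).
Implicit Types (x : nat -> R) (p : R) (n i : nat).

Definition rank x n i : nat := \sum_(j < n) (x j <= x i)%R.

(* Item [n] is the (n+1)-st to arrive, hence its rank on arrival is
   [rank x n.+1 n]. *)
Fixpoint retained x p n : {fset nat} :=
  match n with
  | 0 => fset0
  | 1 => [fset 0%N]%fset
  | (m.+1 as n').+1 =>
      let S := retained x p n' in
      if (rank x n'.+1 n')%:Z <= Num.ceil (p * (#|` S|)%:R)
      then (n' |` S)%fset else S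
  end.

Definition nb_retained x p n : nat := #|` retained x p n|.

Definition sum_ranks x p n : nat := \sum_(i <- retained x p n) rank x n i.

Definition avg_rank x p n : R := (sum_ranks x p n)%:R / (nb_retained x p n)%:R.

Definition V x p n : R := (sum_ranks x p n)%:R / (nb_retained x p n)%:R ^+ 2.

Lemma V_avg_rank x p n : V x p n = avg_rank x p n / (nb_retained x p n)%:R.
Proof. by rewrite /V /avg_rank expr2 invfM mulrA. Qed.

Definition qlim p : R := 2^-1 * p ^+ 2 / (2 * p - 1).

End PercentileRule.

(* Main.v *)
(**
Only the order pattern of the observations matters, and by exchangeability and
absence of ties the n! patterns of n observations are equally likely, so that
the rank of the next item is uniform on 1, ..., n+1 and independent of the
past.  Hence (Q, L) moves as follows: with m = ceil (p L), if the new rank r is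
at most m then L grows by 1 and Q by N_r + r, otherwise Q grows by N_r, where
N_r counts the retained items of rank at least r and the N_r sum to Q.

Put U = Q / ((L - 3/2)(L - 1/2)).  The mean increment of U over step n is
-(2p-1)(U - q_p)/n up to an error O((1+U)/(nL)), and its mean square is
O((1+U)^2/(nL)).  The mean of 1/L decays like a power of n, and therefore so
does the mean of (U - q_p)^2 restricted to the event that L has reached a fixed
level by a fixed time.  This is summable along the subsequence n_k = k^e for e
large, and there L_(n_(k+1)) / L_(n_k) tends to 1; as Q and L are
nondecreasing, almost sure convergence extends to all n.  For the expectations,
the contribution of the complementary event is controlled by the first moment
of U, which obeys a contracting recursion valid at all levels of L.
*)
Require Import Defs.
From HB Require Import structures.
From mathcomp Require Import all_boot all_order all_algebra all_fingroup finmap.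
From mathcomp Require Import zify ring lra.
From mathcomp Require Import all_classical all_reals all_analysis.
From mathcomp Require Import measurable_realfun.

Set Implicit Arguments.
Unset Strict Implicit.
Unset Printing Implicit Defensive.

Import Order.TTheory GRing.Theory Num.Theory.
Import numFieldNormedType.Exports.

Local Open Scope classical_set_scope.
Local Open Scope ring_scope.

(** * Order patterns of finitely many distinct reals and their uniform law *)

Section OrderPatterns.
Context (R : realType).
Implicit Types (x y : nat -> R) (n : nat).

Definition same_order n x y :=
  forall i j, (i < n)%N -> (j < n)%N -> (x i <= x j) = (y i <= y j).

Definition order_invariant n (A : Type) (g : (nat -> R) -> A) :=
  forall x y, same_order n x y -> g x = g y.

Definition distinct n x :=
  forall i j, (i < n)%N -> (j < n)%N -> x i = x j -> i = j.

(** Indices from [n] on get the default 0, which a function invariant at order [n] never sees. *)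
Definition perm_seq n (s : 'S_n) (i : nat) : R :=
  oapp (fun j : 'I_n => (s j)%:R) 0 (insub i).

(* The law of [X_0, ..., X_(n-1)], seen through order comparisons only, is the
   uniform law on the [n!] sequences [perm_seq s]. *)
Definition pattern_mean n (g : (nat -> R) -> R) : R :=
  n`!%:R^-1 * \sum_(s : 'S_n) g (perm_seq s).

Lemma same_orderW m n x y : (m <= n)%N -> same_order n x y -> same_order m x y.
Proof. by move=> mn xy i j im jm; rewrite xy// (leq_trans _ mn). Qed.

Lemma order_invariantW m n A (g : (nat -> R) -> A) : (m <= n)%N ->
  order_invariant m g -> order_invariant n g.
Proof. by move=> mn gm x y /(same_orderW mn)/gm. Qed.

Lemma perm_seqE n (s : 'S_n) (i : 'I_n) : perm_seq s i = (s i)%:R.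
Proof. by rewrite /perm_seq valK. Qed.

Lemma perm_seq_distinct n (s : 'S_n) : distinct n (perm_seq s).
Proof.
move=> i j ilt jlt; rewrite (perm_seqE s (Ordinal ilt)) (perm_seqE s (Ordinal jlt)).
by move=> /eqP; rewrite eqr_nat => /eqP /val_inj /perm_inj [].
Qed.

Lemma same_order_rank n x y i : same_order n x y -> (i < n)%N ->
  rank x n i = rank y n i.
Proof. by move=> xy ilt; apply: eq_bigr => j _; rewrite xy. Qed.

Lemma eq_pattern_mean n (f g : (nat -> R) -> R) :
  (forall s : 'S_n, f (perm_seq s) = g (perm_seq s)) ->
  pattern_mean n f = pattern_mean n g.
Proof. by move=> fg; congr (_ * _); apply: eq_bigr => s _. Qed.

Lemma le_pattern_mean n (f g : (nat -> R) -> R) :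
  (forall s : 'S_n, f (perm_seq s) <= g (perm_seq s)) ->
  pattern_mean n f <= pattern_mean n g.
Proof. by move=> fg; rewrite ler_wpM2l// ?invr_ge0//; apply: ler_sum => s _. Qed.

Lemma pattern_mean_ge0 n (f : (nat -> R) -> R) :
  (forall s : 'S_n, 0 <= f (perm_seq s)) -> 0 <= pattern_mean n f.
Proof. by move=> f0; rewrite mulr_ge0// ?invr_ge0// sumr_ge0. Qed.

Lemma pattern_meanD n (f g : (nat -> R) -> R) :
  pattern_mean n (fun x => f x + g x) = pattern_mean n f + pattern_mean n g.
Proof. by rewrite /pattern_mean big_split mulrDr. Qed.

Lemma pattern_meanZ n c (f : (nat -> R) -> R) :
  pattern_mean n (fun x => c * f x) = c * pattern_mean n f.
Proof. by rewrite /pattern_mean -mulr_sumr mulrCA. Qed.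

Lemma pattern_mean_cst n c : pattern_mean n (fun=> c) = c.
Proof.
by rewrite /pattern_mean sumr_const card_Sn -[c *+ _]mulr_natl mulrA mulVf ?mul1r.
Qed.

Lemma pattern_mean_sum n (I : finType) (f : I -> (nat -> R) -> R) :
  pattern_mean n (fun x => \sum_i f i x) = \sum_i pattern_mean n (f i).
Proof. by rewrite /pattern_mean exchange_big/= mulr_sumr. Qed.

(** Prescribing the last value [r] only relabels the earlier values by [lift r], which is strictly
    increasing. *)
Lemma perm_seq_lift_perm n (r : 'I_n.+1) (s : 'S_n) :
  same_order n (perm_seq (lift_perm ord_max r s)) (perm_seq s).
Proof.
move=> i j ilt jlt.
have lE k (klt : (k < n)%N) :
    perm_seq (lift_perm ord_max r s) k = (lift r (s (Ordinal klt)))%:R.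
  by rewrite -(lift_perm_lift ord_max) -perm_seqE lift_max.
rewrite !lE (perm_seqE s (Ordinal ilt)) (perm_seqE s (Ordinal jlt)) !ler_nat.
by rewrite /= leq_bump2.
Qed.

Lemma rank_perm_seq n (s : 'S_n) (i : 'I_n) : rank (perm_seq s) n i = (s i).+1.
Proof.
rewrite /rank (reindex_inj (@perm_inj _ s^-1%g))/=.
under eq_bigr do rewrite !perm_seqE permKV ler_nat.
transitivity (\sum_(j < (s i).+1) 1)%N; last by rewrite sum1_card card_ord.
rewrite (big_ord_widen n (fun=> 1%N))// [RHS]big_mkcond.
by apply: eq_bigr => j _; rewrite ltnS; case: leqP.
Qed.

(** A permutation is recovered from its last value and the pattern of the others; equality of
    cardinals, $(n+1)! = (n+1)\,n!$, then gives surjectivity. *)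
Lemma lift_perm_bij n :
  bijective (fun rs : 'I_n.+1 * 'S_n => lift_perm ord_max rs.1 rs.2).
Proof.
apply: inj_card_bij; last by rewrite card_prod !card_Sn card_ord factS.
move=> [r s] [r' s'] /= eq_lift; have := congr1 (fun t : 'S_n.+1 => t ord_max) eq_lift.
rewrite !lift_perm_id => rr'; rewrite -{}rr' in eq_lift *; congr pair.
apply/permP => k; have := congr1 (fun t : 'S_n.+1 => t (lift ord_max k)) eq_lift.
by rewrite !lift_perm_lift => /lift_inj.
Qed.

(** Uniformity of the newest rank and its independence of the past: under the bijection above, [r]
    determines this rank and [s] the earlier pattern, and the pair is uniform on a product. *)
Lemma pattern_meanS n (g : nat -> (nat -> R) -> R) :
  (forall r, order_invariant n (g r)) ->
  pattern_mean n.+1 (fun x => g (rank x n.+1 n) x) =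
  n.+1%:R^-1 * \sum_(r < n.+1) pattern_mean n (g r.+1).
Proof.
move=> gn; rewrite /pattern_mean -mulr_sumr mulrA -invfM -natrM -factS.
congr (_ * _); rewrite (reindex _ (onW_bij _ (lift_perm_bij n)))/=.
rewrite pair_bigA/=; apply: eq_bigr => -[r s] _ /=.
rewrite [X in rank _ _ X](_ : n = (ord_max : 'I_n.+1) :> nat)//.
by rewrite rank_perm_seq lift_perm_id; apply: gn; exact: perm_seq_lift_perm.
Qed.

Lemma leq_rank n x i j : (i < n)%N -> (j < n)%N ->
  (rank x n i <= rank x n j)%N = (x i <= x j).
Proof.
move=> ilt jlt; have [xij|xji] := leP (x i) (x j).
  by apply: leq_sum => k _; case: leP => // xki; rewrite (le_trans xki xij).
apply/negbTE; rewrite -ltnNge /rank (bigD1 (Ordinal ilt))//=.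
rewrite [X in (_ < X)%N](bigD1 (Ordinal ilt))//= lexx leNgt xji/= ltnS.
by apply: leq_sum => k _; case: leP => // xkj; rewrite (le_trans xkj (ltW xji)).
Qed.

Lemma rank_gt0 n x i : (i < n)%N -> (0 < rank x n i)%N.
Proof. by move=> ilt; rewrite /rank (bigD1 (Ordinal ilt))//= lexx. Qed.

Lemma rank_le n x i : (rank x n i <= n)%N.
Proof.
rewrite -[leqRHS]card_ord -sum1_card; apply: leq_sum => k _.
by case: (_ <= _).
Qed.

(** The permutation sends [i] to its rank minus one, ranks being counted from 1; absence of ties
    makes this map injective. *)
Lemma distinct_perm_seq n x : distinct n x ->
  exists s : 'S_n, same_order n x (perm_seq s).
Proof.
move=> x_inj.
have rank_lt (i : 'I_n) : ((rank x n i).-1 < n)%N.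
  by rewrite prednK ?rank_le// rank_gt0.
have rank_inj : injective (fun i => Ordinal (rank_lt i)).
  move=> i j [] /(congr1 succn); rewrite !prednK ?rank_gt0// => rij.
  apply: ord_inj; apply: x_inj => //; apply/eqP; rewrite eq_le.
  by rewrite -(leq_rank x (ltn_ord i))// -(leq_rank x (ltn_ord j))// rij leqnn.
exists (perm rank_inj) => i j ilt jlt.
rewrite (perm_seqE _ (Ordinal ilt)) (perm_seqE _ (Ordinal jlt)) !permE ler_nat/=.
by rewrite -(leq_rank x ilt jlt) -[RHS]ltnS !prednK ?rank_gt0.
Qed.

Lemma same_order_perm_seq n (s t : 'S_n) :
  same_order n (perm_seq s) (perm_seq t) -> s = t.
Proof.
move=> st; apply/permP => i; apply/val_inj/succn_inj => /=.
by rewrite -!rank_perm_seq; exact: same_order_rank.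
Qed.

End OrderPatterns.

(** * Exchangeability of i.i.d. sequences *)

Section Exchangeability.
Context d (T : measurableType d) (R : realType) (P : probability T R).
Context (X : nat -> {RV P >-> R}).
Hypotheses (X_indep : mutually_independent X)
           (X_id : identically_distributed X).

(** The point is that the right side does not involve [s]: this is exchangeability on rectangles. *)
Lemma iid_rectangle n (s : 'I_n -> nat) (A : 'I_n -> set R) : injective s ->
  (forall i, measurable (A i)) ->
  P (\bigcap_i (X (s i) @^-1` A i)) = (\prod_i P (X 0%N @^-1` A i))%E.
Proof.
(* [B] transports [A] along [s] to sets indexed by items, with the whole line at indices that [s]
   misses. *)
move=> s_inj mA; pose B j := if [pick i | s i == j] is Some i then A i else setT.
have Bs i : B (s i) = A i.
  by rewrite /B; case: pickP => [k /eqP/s_inj ->//|/(_ i)]; rewrite eqxx.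
have -> : \bigcap_i (X (s i) @^-1` A i) =
    \bigcap_(j in [set` [fset s i | i in 'I_n]%fset]) (X j @^-1` B j).
  apply/seteqP; split => [w wA j /= /imfsetP[i _ ->]|w wB i _].
    by rewrite Bs; exact: wA.
  by rewrite -Bs; apply: wB => /=; rewrite in_imfset.
rewrite X_indep => [|j _]; last by rewrite /B; case: pickP.
rewrite big_imfset => [|i j _ _ /s_inj//].
rewrite (perm_big (index_enum 'I_n)) => [|]; last first.
  apply: uniq_perm; [exact: enum_finmem_uniq|exact: index_enum_uniq|move=> i].
  by rewrite enum_finmemE mem_index_enum.
apply: eq_bigr => i _; rewrite Bs.
exact: (X_id (s i) (mA i)).
Qed.

Definition rectangles n : set (set ('I_n -> R)) :=
  [set B | exists A : 'I_n -> set R,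
    (forall i, measurable (A i)) /\ B = [set x | forall i, A i (x i)]].
Arguments rectangles : clear implicits.

(** Dynkin's argument: rectangles are stable under intersection, and the sets on which both laws
    agree form a lambda-system. Measurability of the two preimages is part of the class, so that
    complements and disjoint unions can be handled. *)
Lemma exchangeable n (s t : 'I_n -> nat) (B : set ('I_n -> R)) :
  injective s -> injective t -> <<s rectangles n >> B ->
  P [set w | B (fun i => X (s i) w)] = P [set w | B (fun i => X (t i) w)].
Proof.
move=> s_inj t_inj.
pose pre (u : 'I_n -> nat) B := [set w | B (fun i => X (u i) w)].
suff : <<s rectangles n >> `<=` [set B | [/\ measurable (pre s B),
    measurable (pre t B) & P (pre s B) = P (pre t B)]] by move=> /[apply] -[].
apply: lambda_system_subset => //.
- move=> _ _ [A [mA ->]] [A' [mA' ->]].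
  exists (fun i => A i `&` A' i); split; first by move=> i; exact: measurableI.
  apply/seteqP; split => [x [xA xA'] i|x xAA']; first by split.
  by split => i; have [] := xAA' i.
- apply/dynkin_lambda_system; split.
  + by split => //; exact: measurableT.
  + move=> C [msC mtC PC].
    have preC u : pre u (~` C) = ~` pre u C by [].
    by rewrite /= !preC !probability_setC// PC; split => //; exact: measurableC.
  + move=> F tF HF; have preU u : pre u (\bigcup_k F k) = \bigcup_k pre u (F k).
      by [].
    have trF u : trivIset setT (fun k => pre u (F k)).
      by move=> i j _ _ [w [wi wj]]; apply: tF => //; exists (fun i => X (u i) w).
    have ms k : measurable (pre s (F k)) by case: (HF k).
    have mt k : measurable (pre t (F k)) by case: (HF k).
    rewrite /= !preU; split; [exact: bigcupT_measurable..|].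
    rewrite !measure_bigcup//.
    by apply: eq_eseriesr => k _; case: (HF k).
- move=> _ [A [mA ->]].
  have preE u : pre u [set x | forall i, A i (x i)] =
      \bigcap_i (X (u i) @^-1` A i).
    by apply/seteqP; split => [w wA i _|w wA i]; [exact: wA|exact: (wA i)].
  rewrite /= !preE; split; last by rewrite !iid_rectangle.
  + by apply: fin_bigcap_measurable => // i _; exact: measurable_funPTI.
  + by apply: fin_bigcap_measurable => // i _; exact: measurable_funPTI.
Qed.

Lemma sigma_rectangles_increasing n :
  <<s rectangles n >> [set x : 'I_n -> R | forall i j, (x i <= x j) = (i <= j)%N].
Proof.
(* Equips the function space with the generated sigma-algebra, for which the coordinates are
   measurable; the set is then a finite intersection of comparisons. *)
pose U := g_sigma_algebraType (rectangles n).
have ev i : measurable_fun [set: U] (fun x : U => x i).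
  move=> _ A mA; rewrite setTI; apply: sub_sigma_algebra.
  exists (fun j => if j == i then A else setT); split=> [j|]; first by case: ifP.
  apply/seteqP; split=> [x xA j|x /(_ i)]; first by case: eqP => [->|].
  by rewrite eqxx.
suff : measurable ([set x | forall i j : 'I_n, (x i <= x j) = (i <= j)%N] : set U) by [].
have -> : [set x : U | forall i j : 'I_n, (x i <= x j) = (i <= j)%N] =
    \bigcap_i \bigcap_j ((fun x : U => x i <= x j) @^-1` [set (i <= j)%N]).
  by apply/seteqP; split => [x xo i _ j _|x xo i j]; [exact: xo|exact: (xo i I j I)].
apply: fin_bigcap_measurable => // i _; apply: fin_bigcap_measurable => // j _.
by rewrite -[X in measurable X]setTI; exact: measurable_fun_ler.
Qed.

End Exchangeability.

(** * Almost sure absence of ties *)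

Section NoTies.
Context d (T : measurableType d) (R : realType) (P : probability T R).
Context (X : nat -> {RV P >-> R}).
Hypotheses (X_indep : mutually_independent X)
           (X_id : identically_distributed X)
           (X_cont : continuous_distribution (X 0%N)).

(** An atom at [a] would be a jump of the distribution function $F$: its mass plus $F(a - 1/(k+1))$
    is at most $F(a)$, and continuity lets $k$ tend to infinity. *)
Lemma distribution_set1 (a : R) : distribution P (X 0%N) [set a] = 0%E.
Proof.
set mu := distribution P (X 0%N).
have fin A : measurable A -> mu A \is a fin_num by move=> mA; exact: fin_num_measure.
have le_cdf k : (mu [set a] + cdf (X 0%N) (a - k.+1%:R^-1) <= cdf (X 0%N) a)%E.
  rewrite /cdf -/mu -measureU//.
  - apply: le_measure; rewrite ?inE//; first exact: measurableU.
    by move=> x /= [->|]; rewrite !in_itv/= ?lexx// => /le_trans; apply; rewrite gerBl.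
  - apply/seteqP; split => x //= [->]; rewrite in_itv/=.
    by rewrite leNgt ltrBlDr ltrDl invr_gt0 ltr0n.
have cvg_a : cdf (X 0%N) (a - k.+1%:R^-1) @[k --> \oo] --> cdf (X 0%N) a.
  have cvg_a0 : a - k.+1%:R^-1 @[k --> \oo] --> a.
    rewrite -[X in _ --> X]subr0; apply: cvgB; first exact: cvg_cst.
    exact: cvg_harmonic.
  exact: (cvg_comp _ _ cvg_a0 (X_cont (x:=a))).
have cvgS : (mu [set a] + cdf (X 0%N) (a - k.+1%:R^-1))%E @[k --> \oo] -->
    (mu [set a] + cdf (X 0%N) a)%E.
  apply: cvgeD => //; last exact: cvg_cst.
  by apply: fin_num_adde_defl; apply: fin.
apply/eqP; rewrite eq_le measure_ge0 andbT.
rewrite -(@leeD2rE _ (cdf (X 0%N) a)) ?add0e; last by apply: fin.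
rewrite -(cvg_lim _ cvgS)//; apply: lime_le; last by apply: nearW.
by apply/cvg_ex; exists (mu [set a] + cdf (X 0%N) a)%E.
Qed.

Lemma measurable_eq_RV (i j : nat) : measurable [set w | X i w = X j w].
Proof.
rewrite (_ : [set w | _] = [set: T] `&` ((fun w => X i w == X j w) @^-1` [set true])).
  by apply: measurable_fun_eqr.
by apply/seteqP; split=> w /=; [move=> ->; rewrite eqxx|case=> _ /eqP].
Qed.

(** The joint law of the two variables is the product measure, by uniqueness on rectangles; the
    sections of the diagonal are single points, hence null. *)
Lemma no_ties (i j : nat) : i != j -> P [set w | X i w = X j w] = 0%E.
Proof.
move=> ij; pose f w := (X i w, X j w).
have mf : measurable_fun setT f by exact: measurable_fun_pair.
pose XX : {mfun T >-> (R * R)%type} := HB.pack f (isMeasurableFun.Build _ _ _ _ f mf).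
have XXE A B : measurable A -> measurable B ->
    pushforward P XX (A `*` B) =
    (distribution P (X 0%N) A * distribution P (X 0%N) B)%E.
  move=> mA mB.
  pose s (k : 'I_2) := if k == ord0 then i else j.
  have s_inj : injective s.
    by move=> [[|[|[]]]//= ?] [[|[|[]]]//= ?]; rewrite /s//= => e; apply/val_inj => //=;
      move: ij; rewrite e ?eqxx// -e eqxx.
  have := iid_rectangle X_indep X_id (A := fun k => if k == ord0 then A else B) s_inj.
  rewrite !big_ord_recl big_ord0 mule1/= => <-; last by move=> k; case: ifP.
  congr (P _); apply/seteqP; split => [w [/= wA wB] k _|w wAB].
    by rewrite /s; case: eqP.
  by split; [exact: (wAB ord0)|exact: (wAB (lift ord0 ord0))].
have mD : measurable [set xy : R * R | xy.1 = xy.2].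
  rewrite (_ : [set xy | _] =
      [set: R * R] `&` ((fun xy => xy.1 == xy.2) @^-1` [set true])).
    by apply: measurable_fun_eqr.
  by apply/seteqP; split=> w /=; [move=> ->; rewrite eqxx|case=> _ /eqP].
transitivity (pushforward P XX [set xy | xy.1 = xy.2]) => //.
rewrite -(product_measure_unique XXE mD).
rewrite /product_measure1/= integral0_eq// => x _ /=.
rewrite (_ : xsection _ _ = [set x]) ?distribution_set1//.
  by apply/seteqP; split => y; rewrite /xsection /= inE/=.
exact: mf.
Qed.

End NoTies.

(** * From probabilities to uniform averages over permutations *)

Section PatternLaw.
Context d (T : measurableType d) (R : realType) (P : probability T R).
Context (X : nat -> {RV P >-> R}).
Hypotheses (X_indep : mutually_independent X)
           (X_id : identically_distributed X)
           (X_cont : continuous_distribution (X 0%N)).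

Let path (w : T) : nat -> R := fun i => X i w.

Let measurable_same_order n (y : nat -> R) :
  measurable [set w | same_order n (path w) y].
Proof.
rewrite (_ : [set w | _] = \bigcap_(i in `I_n) \bigcap_(j in `I_n)
    ((fun w => X i w <= X j w) @^-1` [set (y i <= y j)])); last first.
  by apply/seteqP; split => [w xy i ilt j jlt|w xy i j ilt jlt];
    [exact: xy|exact: (xy i ilt j jlt)].
apply: fin_bigcap_measurable => // i _; apply: fin_bigcap_measurable => // j _.
by rewrite -[X in measurable X]setTI; exact: measurable_fun_ler.
Qed.

Let event n (s : 'S_n) := [set w | same_order n (path w) (perm_seq R s)].

(** All pattern events are preimages of one set, that of increasing tuples, under different
    enumerations of the items; exchangeability therefore gives them equal probability. *)
Let eventE n (s : 'S_n) : event s =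
  [set w | [set x : 'I_n -> R | forall i j, (x i <= x j) = (i <= j)%N]
             (fun a => X (s^-1%g a) w)].
Proof.
apply/seteqP; split => w /= ws i j.
  rewrite [LHS]ws// (perm_seqE _ _ (s^-1 i)%g) (perm_seqE _ _ (s^-1 j)%g).
  by rewrite !permKV ler_nat.
move=> ilt jlt; have := ws (s (Ordinal ilt)) (s (Ordinal jlt)); rewrite !permK => ->.
by rewrite (perm_seqE _ s (Ordinal ilt)) (perm_seqE _ s (Ordinal jlt)) ler_nat.
Qed.

Let prob_event_eq n (s t : 'S_n) : P (event s) = P (event t).
Proof.
rewrite !eventE.
apply: (exchangeable X_indep X_id (s := fun a => s^-1%g a) (t := fun a => t^-1%g a)).
- by move=> i j /val_inj /perm_inj.
- by move=> i j /val_inj /perm_inj.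
- exact: sigma_rectangles_increasing.
Qed.

Let trivIset_event n : trivIset [set` index_enum 'S_n] (@event n).
Proof.
move=> s t _ _ [w [ws wt]]; apply: (@same_order_perm_seq R).
by move=> i j ilt jlt; rewrite -ws// -wt.
Qed.

Let all_events n := \big[setU/set0]_(s : 'S_n) event s.

Let measurable_all_events n : measurable (all_events n).
Proof. by apply: bigsetU_measurable => s _; exact: measurable_same_order. Qed.

Let prob_no_event n : P (~` all_events n) = 0%E.
Proof.
apply/negligibleP; first exact: measurableC.
(* An outcome without a pattern has a tie, so it lies in a countable union of null events. *)
apply: (@negligibleS _ _ _ _
  (\bigcup_i \bigcup_j [set w | i != j /\ X i w = X j w])).
  move=> w Nw; apply: contrapT => Nij; apply: Nw.
  have [i j _ _ xij|s ws] := @distinct_perm_seq R n (path w).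
    by apply/eqP; apply/negP => /negP ij; apply: Nij; exists i => //; exists j.
  by rewrite /all_events (bigD1 s)//=; left.
apply: negligible_bigcup => i; apply: negligible_bigcup => j.
have [->|ij] := eqVneq i j.
  by apply: negligibleS (negligible_set0 _) => w [].
apply: (@negligibleS _ _ _ _ [set w | X i w = X j w]); first by move=> w [].
apply/negligibleP; first exact: measurable_eq_RV.
exact: no_ties.
Qed.

Let prob_event n (s : 'S_n) : P (event s) = (n`!%:R^-1)%:E.
Proof.
have : P (all_events n) = 1%E.
  have := probability_setC P (measurable_all_events n); rewrite prob_no_event.
  have := fin_num_measure P _ (measurable_all_events n).
  by case: (P _) => //= r _ [] /eqP; rewrite eq_sym subr_eq0 => /eqP <-.
rewrite /all_events -bigcup_seq measure_fin_bigcup//; last 2 first.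
- exact: trivIset_event.
- by move=> t _; exact: measurable_same_order.
rewrite -fsbig_seq ?index_enum_uniq//.
have [r rE] : exists r, P (event s) = r%:E.
  exists (fine (P (event s))); rewrite fineK//.
  by apply: fin_num_measure; exact: measurable_same_order.
rewrite (eq_bigr (fun=> r%:E)) => [|t _]; last by rewrite -rE; exact: prob_event_eq.
rewrite sumEFin sumr_const card_Sn rE => -[] rn.
congr EFin; apply: (mulfI (_ : n`!%:R != 0)); first by [].
by rewrite divff// mulr_natl.
Qed.

(** The function factors through the finite table [pat] of comparisons, so each preimage is a finite
    union of measurable sets. *)
Lemma measurable_order_invariant n (g : (nat -> R) -> R) :
  order_invariant n g -> measurable_fun setT (fun w => g (fun i => X i w)).
Proof.
move=> gn _ Y mY; rewrite setTI.
pose pat (w : T) : {ffun 'I_n * 'I_n -> bool} :=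
  [ffun ij : 'I_n * 'I_n => X ij.1 w <= X ij.2 w].
have -> : (fun w => g (path w)) @^-1` Y =
    \bigcup_(e in [set pat w | w in (fun w => g (path w)) @^-1` Y])
      [set w | pat w = e].
  apply/seteqP; split => [w Yw|w [e [w' Yw' <-]] /= ww'].
    by exists (pat w) => //; exists w.
  rewrite /preimage/= (gn _ (path w'))// => i j ilt jlt.
  have := congr1 (fun e : {ffun _ -> bool} => e (Ordinal ilt, Ordinal jlt)) ww'.
  by rewrite !ffunE.
apply: fin_bigcup_measurable; first exact: finite_finset.
move=> _ [w' _ <-]; rewrite (_ : mkset _ = [set w | same_order n (path w) (path w')]) //.
apply/seteqP; split => w /= ww'.
  move=> i j ilt jlt.
  have := congr1 (fun e : {ffun _ -> bool} => e (Ordinal ilt, Ordinal jlt)) ww'.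
  by rewrite !ffunE.
by apply/ffunP => -[i j]; rewrite !ffunE ww'.
Qed.

(** The bridge to finite combinatorics: up to a null set the space splits into the pattern events,
    each of probability $1/n!$, and the integrand is constant on each. *)
Lemma expectation_order_invariant n (g : (nat -> R) -> R) :
  order_invariant n g ->
  ('E_P[fun w => g (fun i => X i w)] = (pattern_mean n g)%:E)%E.
Proof.
move=> gn; have /measurable_EFinP mg := measurable_order_invariant gn.
rewrite unlock.
pose f w := (g (path w))%:E.
transitivity (\int[P]_(w in all_events n) f w)%E.
  rewrite [RHS]integral_mkcond; apply: ae_eq_integral => //.
    apply/(measurable_restrictT _ (measurable_all_events n)).
    exact: measurable_funTS.
  exists (~` all_events n); split; [exact: measurableC|exact: prob_no_event|].
  by move=> w /= /not_implyP[_ Nw] aw; apply: Nw; rewrite patchE mem_set.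
rewrite integral_bigsetU_EFin//; last 4 first.
- by move=> s; exact: measurable_same_order.
- exact: index_enum_uniq.
- exact: trivIset_event.
- exact: measurable_funTS.
rewrite /pattern_mean mulr_sumr -sumEFin; apply: eq_bigr => s _.
rewrite (eq_integral (cst (g (perm_seq R s))%:E)); last first.
  by move=> w /set_mem ws; congr EFin; exact: gn.
rewrite integral_cst//=; last exact: measurable_same_order.
by rewrite -/(event s) prob_event -EFinM mulrC.
Qed.

End PatternLaw.

(** * The motion of the rank sum and of the number of retained items *)

Section Dynamics.
Context (R : realType) (p : R).
Implicit Types (x y : nat -> R) (n r i : nat).

Definition threshold (l : nat) : nat := `|Num.ceil (p * l%:R)|%N.

(** The count $N_r$: these are the retained items that a newcomer of rank [r] pushes up by one. *)
Definition nb_ge x n r : nat := \sum_(i <- retained x p n) (r <= rank x n i)%N.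

Lemma retained_lt x n i : i \in retained x p n -> (i < n)%N.
Proof.
elim: n => [//|[_|n IH]]; first by rewrite /= inE => /eqP ->.
rewrite [retained _ _ _]/=; case: ifP => _; last by move=> /IH /ltnW.
by rewrite in_fset1U => /orP[/eqP ->|/IH /ltnW].
Qed.

Lemma order_invariant_retained n : order_invariant n (fun x => retained x p n).
Proof.
elim: n => [//|[//|n IH]] x y xy; rewrite /= -!/(retained _ p n.+1).
rewrite (same_order_rank xy)//.
by have -> : retained x p n.+1 = retained y p n.+1 by apply: IH; exact: same_orderW xy.
Qed.

Lemma order_invariant_nb_retained n :
  order_invariant n (fun x => nb_retained x p n).
Proof. by move=> x y xy; rewrite /nb_retained (order_invariant_retained xy). Qed.

Lemma order_invariant_sum_ranks n : order_invariant n (fun x => sum_ranks x p n).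
Proof.
move=> x y xy; rewrite /sum_ranks (order_invariant_retained xy).
rewrite big_seq [RHS]big_seq; apply: eq_bigr => i /retained_lt ilt.
exact: same_order_rank.
Qed.

Lemma order_invariant_nb_ge n r : order_invariant n (fun x => nb_ge x n r).
Proof.
move=> x y xy; rewrite /nb_ge (order_invariant_retained xy).
rewrite big_seq [RHS]big_seq; apply: eq_bigr => i /retained_lt ilt.
by rewrite (same_order_rank xy).
Qed.

Lemma rank_recr x n i : rank x n.+1 i = (rank x n i + (x n <= x i)%R)%N.
Proof. by rewrite /rank big_ord_recr. Qed.

Lemma rankS x n i : distinct n.+1 x -> (i < n)%N ->
  rank x n.+1 i = (rank x n i + (rank x n.+1 n <= rank x n i))%N.
Proof.
move=> x_inj ilt; have rE := rank_recr x n i; rewrite rE; congr (_ + nat_of_bool _)%N.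
have iltS := leqW ilt.
have := @leq_rank R n.+1 x n i (ltnSn n) iltS.
rewrite rE; case: (boolP (x n <= x i)) => /= [xni|_]; last by rewrite addn0 => ->.
(* In the boundary case the newcomer and item [i] have equal new ranks, hence equal values, which
   distinctness excludes. *)
rewrite addn1 leq_eqVlt => /orP[/eqP rn|]; last by rewrite ltnS => ->.
have := @leq_rank R n.+1 x i n iltS (ltnSn n).
rewrite rE rn xni addn1 leqnn => /esym xin.
have /x_inj xinE : x i = x n by apply/eqP; rewrite eq_le xin xni.
by have := xinE iltS (ltnSn n) => in_; rewrite in_ ltnn in ilt.
Qed.

Hypotheses (p_gt : 2^-1 < p) (p_le : p <= 1).

Let p_gt0 : 0 < p. Proof. by rewrite (lt_trans _ p_gt). Qed.

Lemma ceil_threshold l : Num.ceil (p * l%:R) = (threshold l)%:Z.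
Proof.
rewrite /threshold gez0_abs// -(ler_int R) (le_trans _ (ceil_ge _))//.
by rewrite mulr_ge0// ltW.
Qed.

Lemma threshold_ge l : p * l%:R <= (threshold l)%:R.
Proof. by rewrite (le_trans (ceil_ge _))// ceil_threshold. Qed.

Lemma threshold_lt l : (threshold l)%:R < p * l%:R + 1.
Proof.
by have := ceilB1_lt (p * l%:R); rewrite ceil_threshold intrB ltrBlDr.
Qed.

Lemma threshold_le l : (threshold l <= l)%N.
Proof.
rewrite -lez_nat -ceil_threshold ceil_le_int// ler_piMl//.
Qed.

Lemma threshold_half l : (0 < l)%N -> (l < 2 * threshold l)%N.
Proof.
move=> l0; rewrite -(ltr_nat R) natrM.
have := threshold_ge l; have : 2^-1 * l%:R < p * l%:R by rewrite ltr_pM2r// ltr0n.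
lra.
Qed.

Lemma retainedS x n : (0 < n)%N -> retained x p n.+1 =
  if (rank x n.+1 n <= threshold (nb_retained x p n))%N
  then (n |` retained x p n)%fset else retained x p n.
Proof. by case: n => // n _; rewrite /= ceil_threshold lez_nat. Qed.

Lemma nb_retainedS x n : (0 < n)%N -> nb_retained x p n.+1 =
  (nb_retained x p n + (rank x n.+1 n <= threshold (nb_retained x p n)))%N.
Proof.
move=> n0; rewrite {1}/nb_retained retainedS//; case: ifP => _; last by rewrite addn0.
rewrite cardfsU1 addnC -/(nb_retained x p n).
by case: (boolP (n \in _)) => // /retained_lt; rewrite ltnn.
Qed.

Lemma nb_retained_gt0 x n : (0 < n)%N -> (0 < nb_retained x p n)%N.
Proof.
elim: n => // -[_ _|n IH _]; first by rewrite /nb_retained/= cardfs1.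
by rewrite nb_retainedS// (leq_trans (IH _))// leq_addr.
Qed.

Lemma sum_ranksS x n : (0 < n)%N -> distinct n.+1 x ->
  sum_ranks x p n.+1 = (sum_ranks x p n + nb_ge x n (rank x n.+1 n) +
    (rank x n.+1 n <= threshold (nb_retained x p n)) * rank x n.+1 n)%N.
Proof.
move=> n0 x_inj.
have old : (\sum_(i <- retained x p n) rank x n.+1 i =
    sum_ranks x p n + nb_ge x n (rank x n.+1 n))%N.
  rewrite /sum_ranks /nb_ge -big_split/= big_seq [RHS]big_seq.
  by apply: eq_bigr => i /retained_lt ilt; exact: rankS.
rewrite {1}/sum_ranks retainedS //; case: ifP => _; last by rewrite mul0n addn0 old.
rewrite big_fsetU1/=; last by apply/negP => /retained_lt; rewrite ltnn.
by rewrite old mul1n addnC.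
Qed.

Lemma nb_ge_le x n r : (nb_ge x n r <= nb_retained x p n)%N.
Proof.
by rewrite /nb_retained card_fset_sum1; apply: leq_sum => i _; exact: leq_b1.
Qed.

Lemma sum_nb_ge x n : (\sum_(r < n.+1) nb_ge x n r.+1 = sum_ranks x p n)%N.
Proof.
rewrite /nb_ge exchange_big/= /sum_ranks; apply: eq_bigr => i _.
have rn : (rank x n i <= n.+1)%N by rewrite (leq_trans (rank_le _ _ _)).
transitivity (\sum_(r < rank x n i) 1)%N; last by rewrite sum1_card card_ord.
rewrite (big_ord_widen n.+1 (fun=> 1%N))// [RHS]big_mkcond.
by apply: eq_bigr => j _; case: leqP.
Qed.

(** As long as one item is retained it is the best so far, since a better one would have rank 1 and
    be accepted. This settles the level [l = 1], where [weight] has a special value. *)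
Lemma sum_ranks1 x n : (0 < n)%N -> distinct n x -> nb_retained x p n = 1%N ->
  sum_ranks x p n = 1%N.
Proof.
elim: n => // -[_ _ _ _|n IH _ x_inj].
  by rewrite /sum_ranks/= big_seq_fset1 /rank big_ord1 lexx.
have L0 := nb_retained_gt0 x (ltn0Sn n).
rewrite nb_retainedS// sum_ranksS//; case: leqP => [|tr]; first by lia.
rewrite addn0 mul0n addn0 => L1; rewrite L1 in tr.
have Q1 : sum_ranks x p n.+1 = 1%N.
  by apply: IH => // i j ilt jlt; apply: x_inj; lia.
rewrite Q1; have := @threshold_half 1 isT.
move=> t1; suff -> : nb_ge x n.+1 (rank x n.+2 n.+1) = 0%N by [].
have r2 : (2 <= rank x n.+2 n.+1)%N by lia.
(* A rejected newcomer has rank at least 2, so every item it pushes up contributes at least 2 to a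
   rank sum equal to 1. *)
suff : (2 * nb_ge x n.+1 (rank x n.+2 n.+1) <= sum_ranks x p n.+1)%N by rewrite Q1; lia.
rewrite /nb_ge /sum_ranks big_distrr/=; apply: leq_sum => i _.
by case: leqP => //= h; lia.
Qed.

Lemma nb_retained_homo x : {homo nb_retained x p : m n / (m <= n)%N}.
Proof.
apply: homo_leq => [//|? ? ? /leq_trans h /h//|[|n]].
  by rewrite (_ : nb_retained x p 0 = 0%N)//; exact: cardfs0.
by rewrite [leqRHS]nb_retainedS// leq_addr.
Qed.

Lemma sum_ranks_homo x : {homo sum_ranks x p : m n / (m <= n)%N}.
Proof.
apply: homo_leq => [//|? ? ? /leq_trans h /h//|[|n]].
  by rewrite (_ : sum_ranks x p 0 = 0%N)//; exact: big_seq_fset0.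
have le_old : (sum_ranks x p n.+1 <= \sum_(i <- retained x p n.+1) rank x n.+2 i)%N.
  by apply: leq_sum => i _; rewrite [leqRHS]rank_recr leq_addr.
apply: (leq_trans le_old); rewrite /sum_ranks (retainedS x (ltn0Sn n)); case: ifP => // _.
rewrite big_fsetU1; last by apply/negP => /retained_lt; rewrite ltnn.
exact: leq_addl.
Qed.

(** The transition of the chain $(Q, L)$. The dependence of [phi] on [x] serves to carry indicators
    of past events. *)
Lemma pattern_mean_step n (phi : (nat -> R) -> nat -> nat -> R) : (0 < n)%N ->
  (forall k l, order_invariant n (fun x => phi x k l)) ->
  pattern_mean n.+1 (fun x => phi x (sum_ranks x p n.+1) (nb_retained x p n.+1)) =
  pattern_mean n (fun x => n.+1%:R^-1 * \sum_(r < n.+1)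
    phi x (sum_ranks x p n + nb_ge x n r.+1 +
             (r.+1 <= threshold (nb_retained x p n)) * r.+1)%N
          (nb_retained x p n + (r.+1 <= threshold (nb_retained x p n)))%N).
Proof.
move=> n0 phi_inv.
pose g r x := phi x (sum_ranks x p n + nb_ge x n r +
             (r <= threshold (nb_retained x p n)) * r)%N
          (nb_retained x p n + (r <= threshold (nb_retained x p n)))%N.
have gn r : order_invariant n (g r).
  move=> x y xy; rewrite /g (order_invariant_sum_ranks xy).
  rewrite (order_invariant_nb_retained xy) (order_invariant_nb_ge r xy).
  exact: phi_inv.
transitivity (pattern_mean n.+1 (fun x => g (rank x n.+1 n) x)).
  apply: eq_pattern_mean => s; rewrite /g -nb_retainedS//.
  by rewrite -sum_ranksS//; exact: perm_seq_distinct.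
by rewrite pattern_meanS// pattern_meanZ pattern_mean_sum.
Qed.

Lemma pattern_mean_const n (g : (nat -> R) -> R) :
  order_invariant n g -> pattern_mean n.+1 g = pattern_mean n g.
Proof.
move=> gn; rewrite (@pattern_meanS _ n (fun=> g))// sumr_const card_ord.
by rewrite -[pattern_mean n g *+ _]mulr_natl mulrA mulVf ?mul1r.
Qed.

End Dynamics.

(** * One-step estimates for abstract data *)

Section OneStep.
Context (R : realType) (p : R).

(* [4 / ((2 l - 3) (2 l - 1)) = 1 / ((l - 3/2) (l - 1/2))], equivalent to
   [1 / l ^ 2]: unit spacing of the two factors makes the decrement telescope to
   [weight l * 4 / (2 l + 1)], and the shift [3/2] makes the mean of
   [Q * weight L] contract for every [L >= 2], even when [p] is close to [1/2].
   The formula would be negative at [l = 1]. *)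
Definition weight (l : nat) : R :=
  if (l <= 1)%N then 1 else 4 / ((2 * l%:R - 3) * (2 * l%:R - 1)).

Lemma weight_ge0 l : 0 <= weight l.
Proof.
rewrite /weight; case: leqP => // l1.
have l2 : 2 <= l%:R :> R by rewrite (ler_nat R 2).
by rewrite divr_ge0// mulr_ge0//; lra.
Qed.

(* With [v = |U - q|], hence [U <= v + q], the cross term and the quadratic term
   of the increment of [v ^ 2] add up to
   [2 v (2 U + 11) + 6 U + (2 U + 3) ^ 2 <= sqr_const * (1 + v ^ 2)]. *)
Definition sqr_const : R := let q := qlim p in
  26 + 8 * q + 2 * (2 * q + 3) ^+ 2.

(** This is [n.+1] times the conditional mean of [phi Q L] after one arrival, given $Q = k$, $L =
    l$, the threshold [m] and the counts [N]. *)
Definition next_sum (n l m k : nat) (N : nat -> nat) (phi : nat -> nat -> R) :=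
  \sum_(r < n.+1)
    phi (k + N r.+1 + (r.+1 <= m) * r.+1)%N (l + (r.+1 <= m))%N.

Hypotheses (p_gt : 2^-1 < p) (p_le : p <= 1).
Lemma qlim_ge0 : 0 <= qlim p.
Proof.
have pg := p_gt; apply: divr_ge0; last by lra.
by apply: mulr_ge0; [rewrite invr_ge0|exact: sqr_ge0].
Qed.

Lemma sqr_const_ge0 : 0 <= sqr_const.
Proof.
have q0 := qlim_ge0; have q2 := sqr_ge0 (2 * qlim p + 3).
by rewrite /sqr_const; lra.
Qed.

Variables (n l m k : nat) (N : nat -> nat).
Hypotheses (l_gt0 : (0 < l)%N) (l_le : (l <= n)%N) (m_le : (m <= l)%N)
  (m_half : (l < 2 * m)%N) (m_ge : p * l%:R <= m%:R) (m_lt : m%:R < p * l%:R + 1)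
  (N_le : forall r, (N r <= l)%N) (N_sum : (\sum_(r < n.+1) N r.+1 = k)%N).

Let sum_select (f : nat -> R) :
  \sum_(r < n.+1) (r.+1 <= m)%:R * f r = \sum_(r < m) f r.
Proof.
rewrite (big_ord_widen n.+1 f); last by rewrite (leq_trans m_le)// leqW.
rewrite [RHS]big_mkcond; apply: eq_bigr => i _.
by case: leqP; rewrite /= ?mulr0n ?mulr1n ?mul0r ?mul1r.
Qed.

Let sum_selected : \sum_(r < n.+1) (r.+1 <= m)%:R = m%:R :> R.
Proof.
transitivity (\sum_(r < n.+1) (r.+1 <= m)%:R * 1 : R).
  by under [RHS]eq_bigr do rewrite mulr1.
by rewrite (sum_select (fun=> 1)) sumr_const card_ord.
Qed.

Let sum_selected_rank :
  \sum_(r < n.+1) (r.+1 <= m)%:R * r.+1%:R = m%:R * (m%:R + 1) / 2 :> R.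
Proof.
rewrite (sum_select (fun r => r.+1%:R)); elim: (m) => [|j IH].
  by rewrite big_ord0 mul0r mul0r.
by rewrite big_ord_recr/= IH -natr1; field.
Qed.

Let N_sumR : \sum_(r < n.+1) (N r.+1)%:R = k%:R :> R.
Proof. by rewrite -natr_sum N_sum. Qed.

Lemma step_count (f : nat -> R) : next_sum n l m k N (fun _ => f) =
  n.+1%:R * f l + m%:R * (f l.+1 - f l).
Proof.
transitivity (\sum_(r < n.+1) (f l + (r.+1 <= m)%:R * (f l.+1 - f l))).
  apply: eq_bigr => r _; case: (_ <= m)%N; rewrite /= ?addn1 ?addn0.
    by rewrite mul1r addrC subrK.
  by rewrite mul0r addr0.
by rewrite big_split/= -mulr_suml sum_selected sumr_const card_ord -[f l *+ _]mulr_natl.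
Qed.

(** The increment is $-m/(l(l+1))$, and $m/(l+1) \ge pl/(l+1) \ge p/2$ because $l \ge 1$. *)
Lemma step_inv :
  next_sum n l m k N (fun _ l' => l'%:R^-1) <= l%:R^-1 * (n.+1%:R - p / 2).
Proof.
have [pg pl mg ml] := And4 p_gt p_le m_ge m_lt.
rewrite step_count.
have lR : 1 <= l%:R :> R by rewrite ler1n.
rewrite [n.+1%:R * _]mulrC [leRHS]mulrBr lerD2l -subr_ge0 -[l.+1%:R]natr1.
have -> : - (l%:R^-1 * (p / 2)) - m%:R * ((l%:R + 1)^-1 - l%:R^-1) =
   (m%:R / (l%:R + 1) - p / 2) / l%:R :> R by field; lra.
apply: divr_ge0 => //; rewrite subr_ge0 ler_pdivlMr; last by lra.
have : 0 <= p * (l%:R - 1) by rewrite mulr_ge0//; lra.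
lra.
Qed.

Let lR2 : (1 < l)%N -> 2 <= l%:R :> R.
Proof. by move=> l1; rewrite (ler_nat R 2). Qed.

Let weightE j : (1 < j)%N -> weight j = 4 / ((2 * j%:R - 3) * (2 * j%:R - 1)).
Proof. by move=> j1; rewrite /weight leqNgt j1. Qed.

Let weightS : weight l.+1 = 4 / ((2 * l%:R - 1) * (2 * l%:R + 1)).
Proof.
rewrite weightE ?ltnS// -natr1; congr (_ / (_ * _)); ring.
Qed.

Let U := k%:R * weight l.
Let del := weight l - weight l.+1.
(** The shifts caused by accepted ranks; as [A] is at most [m * l] and [del] is of order $l^{-3}$
    (relative to $Q$ of order 1), their product is $O(1/l)$. *)
Let A : R := \sum_(r < n.+1) (r.+1 <= m)%:R * (N r.+1)%:R.

Let A_ge0 : 0 <= A. Proof. by apply: sumr_ge0 => r _; rewrite mulr_ge0. Qed.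

Let A_le : A <= m%:R * l%:R.
Proof.
rewrite -sum_selected mulr_suml; apply: ler_sum => r _.
by rewrite ler_wpM2l// ler_nat.
Qed.

Let delE : (1 < l)%N -> del = weight l * (4 / (2 * l%:R + 1)).
Proof.
move=> l1; have := lR2 l1 => l2; rewrite /del weightS weightE//; field.
by apply/and3P; split; lra.
Qed.

Let U_ge0 : 0 <= U.
Proof. by rewrite mulr_ge0// weight_ge0. Qed.

(** The increment of [U] when the newcomer has rank [r.+1]: the shift at the old weight, then on
    acceptance the change of weight and the new rank. *)
Let drift r : R := (N r.+1)%:R * weight l +
  (r.+1 <= m)%:R * (- (k%:R + (N r.+1)%:R) * del + r.+1%:R * weight l.+1).

Let driftE (r : nat) :
  (k + N r.+1 + (r.+1 <= m) * r.+1)%:R * weight (l + (r.+1 <= m))%N =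
  U + drift r.
Proof.
rewrite /drift /U /del; case: (_ <= m)%N;
  rewrite /= !natrD ?mul1n ?mul0n ?addn1 ?addn0; ring.
Qed.

(** For large [l] the four terms are about $U$, $-2pU$, 0 and $p^2/2$. Their sum is $-(2p-1)(U -
    q_p)$, which is where [qlim p] comes from. *)
Let sum_drift : \sum_(r < n.+1) drift r =
  U - m%:R * k%:R * del - A * del + m%:R * (m%:R + 1) / 2 * weight l.+1.
Proof.
transitivity (\sum_(r < n.+1) ((N r.+1)%:R * weight l +
    ((r.+1 <= m)%:R * (- (k%:R * del)) + ((r.+1 <= m)%:R * (N r.+1)%:R) * (- del) +
     ((r.+1 <= m)%:R * r.+1%:R) * weight l.+1))).
  by apply: eq_bigr => r _; rewrite /drift; ring.
rewrite !big_split/= -!mulr_suml N_sumR sum_selected sum_selected_rank /U -/A.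
by rewrite !mulrN !addrA !mulrA.
Qed.

Lemma step_weight : (l = 1%N -> k = 1%N) ->
  next_sum n l m k N (fun k' l' => k'%:R * weight l') <=
  k%:R * weight l * (n.+1%:R - (2 * p - 1) / 3) + 5.
Proof.
have [pg pl mg ml] := And4 p_gt p_le m_ge m_lt.
move=> k1; rewrite -/U /next_sum; under eq_bigr do rewrite driftE.
rewrite big_split/= sum_drift sumr_const card_ord -[U *+ n.+1]mulr_natr.
have nR : 1 <= n.+1%:R :> R by rewrite ler1n.
case: (ltnP 1 l) => [l1|l1].
  have l2 := lR2 l1.
  have -> : m%:R * k%:R * del = U * (m%:R * (4 / (2 * l%:R + 1))).
    by rewrite delE// /U; ring.
  have del0 : 0 <= del.
    by rewrite delE// mulr_ge0 ?weight_ge0// divr_ge0//; lra.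
  have AD : 0 <= A * del by rewrite mulr_ge0.
  have B1 : m%:R * (m%:R + 1) / 2 * weight l.+1 <= 5.
    rewrite weightS mulrA ler_pdivrMr; last by nra.
    have mR : m%:R <= l%:R :> R by rewrite ler_nat.
    have m0 : 0 <= m%:R :> R by [].
    nra.
  suff : U * (1 - m%:R * (4 / (2 * l%:R + 1))) <= - U * ((2 * p - 1) / 3) by lra.
  rewrite mulNr -mulrN ler_wpM2l//.
  rewrite -subr_ge0.
  have -> : - ((2 * p - 1) / 3) - (1 - m%:R * (4 / (2 * l%:R + 1))) =
     (4 * m%:R - 2 * l%:R - 1 - (2 * p - 1) / 3 * (2 * l%:R + 1)) / (2 * l%:R + 1).
    by field; lra.
  apply: divr_ge0; last by lra.
  (* The average of the lower bounds $4pl$ and $2l+2$ for $4m$ leaves $(2p-1)l$ in the numerator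
     before the last subtraction, and $l \ge (2l+1)/3$. *)
  have : l.+1%:R <= (2 * m)%:R :> R by rewrite ler_nat.
  rewrite natrM -natr1 => h1.
  nra.
(* At level 1 all is explicit: [k = m = 1], and [weight] rises from 1 to 4/3, so [del] is negative;
   the constant 5 absorbs the increment. *)
have l1E : l = 1%N by apply/eqP; rewrite eqn_leq l1.
have m1 : m = 1%N by move: m_le m_half; rewrite l1E; case: (m) => [|[|]].
have U1 : U = 1 by rewrite /U k1// l1E /weight/= mulr1.
have := A_ge0.
rewrite U1 m1 (k1 l1E) /del /weight l1E/= => A0.
have A1 : A <= 1 by rewrite (le_trans A_le)// m1 l1E mulr1.
have -> : (2 * 2 - 3) * (2 * 2 - 1) = 3 :> R by ring.
lra.
Qed.

Let drift_le (r : nat) : (1 < l)%N -> (r.+1 <= m)%N ->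
  `|drift r| <= k%:R * del + 2 * l%:R * weight l.+1.
Proof.
move=> l1 rm; rewrite /drift rm mul1r.
have -> : (N r.+1)%:R * weight l +
    (- (k%:R + (N r.+1)%:R) * del + r.+1%:R * weight l.+1) =
    (N r.+1)%:R * weight l.+1 + r.+1%:R * weight l.+1 - k%:R * del.
  by rewrite /del; ring.
have Nl : (N r.+1)%:R * weight l.+1 <= l%:R * weight l.+1.
  by rewrite ler_wpM2r ?weight_ge0// ler_nat.
have rl : r.+1%:R * weight l.+1 <= l%:R * weight l.+1.
  by rewrite ler_wpM2r ?weight_ge0// ler_nat (leq_trans rm).
have N0 : 0 <= (N r.+1)%:R * weight l.+1 by rewrite mulr_ge0 ?weight_ge0.
have r0 : 0 <= r.+1%:R * weight l.+1 by rewrite mulr_ge0 ?weight_ge0.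
have d0 : 0 <= k%:R * del.
  by have l2 := lR2 l1; rewrite mulr_ge0// delE// mulr_ge0 ?weight_ge0// divr_ge0//; lra.
by rewrite ler_norml; apply/andP; split; lra.
Qed.

(** A rejected newcomer changes [U] by [N * weight l]: of the square, one factor [N] is bounded by
    [l] and the other sums to [k]. Each of the [m] accepted ranks contributes at most [B ^ 2], with
    [B] of order $(1+U)/l$. *)
Let sum_sqr_drift : (1 < l)%N ->
  \sum_(r < n.+1) drift r ^+ 2 <= (6 * U + (2 * U + 3) ^+ 2) / l%:R.
Proof.
move=> l1; have l2 := lR2 l1; set B := k%:R * del + 2 * l%:R * weight l.+1.
have B_le : B <= (2 * U + 3) / l%:R.
  rewrite /B delE// mulrA -/U weightS.
  have U1 : U * (4 / (2 * l%:R + 1)) <= 2 * U / l%:R.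
    have -> : 2 * U / l%:R = U * (2 / l%:R) by ring.
    rewrite ler_wpM2l//.
    rewrite -subr_ge0 (_ : _ - _ = 2 / (l%:R * (2 * l%:R + 1))).
      by rewrite divr_ge0// mulr_ge0//; lra.
    by field; apply/andP; split; lra.
  have w1 : 2 * l%:R * (4 / ((2 * l%:R - 1) * (2 * l%:R + 1))) <= 3 / l%:R :> R.
    rewrite -subr_ge0 (_ : _ - _ =
        (4 * (l%:R * l%:R) - 3) / (l%:R * ((2 * l%:R - 1) * (2 * l%:R + 1)))).
      have l4 : 4 <= l%:R * l%:R :> R by rewrite (_ : 4 = 2 * 2) ?ler_pM//; ring.
      by rewrite divr_ge0 ?mulr_ge0//; lra.
    by field; apply/and3P; split; lra.
  by rewrite [leRHS]mulrDl lerD.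
have drift2 (r : 'I_n.+1) : drift r ^+ 2 <=
    (N r.+1)%:R * (l%:R * weight l ^+ 2) + (r.+1 <= m)%:R * B ^+ 2.
  have NlB : 0 <= (N r.+1)%:R * (l%:R * weight l ^+ 2).
    by rewrite mulr_ge0// mulr_ge0// sqr_ge0.
  have [rm|rm] := leqP r.+1 m.
    rewrite mul1r ler_wpDl// -[leLHS]real_normK ?num_real//.
    by rewrite lerXn2r ?nnegrE// (le_trans _ (drift_le l1 rm)) ?drift_le.
  rewrite /drift leqNgt rm/= !mul0r !addr0 exprMn expr2 -mulrA ler_wpM2l//.
  by rewrite ler_wpM2r ?sqr_ge0// ler_nat.
have B0 : 0 <= B.
  rewrite addr_ge0// mulr_ge0 ?weight_ge0//.
  by rewrite delE// mulr_ge0 ?weight_ge0// divr_ge0//; lra.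
apply: (le_trans (ler_sum _ (fun r _ => drift2 r))).
rewrite big_split/= -!mulr_suml N_sumR sum_selected mulrDl; apply: lerD.
  have -> : k%:R * (l%:R * weight l ^+ 2) = U * (l%:R * weight l) by rewrite /U; ring.
  have -> : 6 * U / l%:R = U * (6 / l%:R) by ring.
  rewrite ler_wpM2l// weightE//.
  have num0 : 0 <= (5 * l%:R - 2) * (l%:R - 2) :> R by rewrite mulr_ge0//; lra.
  rewrite -subr_ge0 (_ : _ - _ = (4 * ((5 * l%:R - 2) * (l%:R - 2)) + 2) /
      (l%:R * ((2 * l%:R - 3) * (2 * l%:R - 1)))).
    apply: divr_ge0; first by lra.
    by rewrite mulr_ge0// mulr_ge0//; lra.
  by field; apply/and3P; split; lra.
have l0 : 0 < l%:R :> R by lra.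
have U0 := U_ge0.
apply: (@le_trans _ _ (l%:R * ((2 * U + 3) / l%:R) ^+ 2)).
  by rewrite ler_pM ?ler_nat ?sqr_ge0// lerXn2r ?nnegrE// divr_ge0//; lra.
by rewrite exprMn le_eqVlt; apply/orP; left; apply/eqP; field; lra.
Qed.

Let sum_drift_near : (1 < l)%N ->
  `|\sum_(r < n.+1) drift r + (2 * p - 1) * (U - qlim p)| <= (2 * U + 11) / l%:R.
Proof.
have [pg pl mg ml] := And4 p_gt p_le m_ge m_lt.
move=> l1; have l2 := lR2 l1; have pl0 : 0 <= p * l%:R by rewrite mulr_ge0//; lra.
have pql : (2 * p - 1) * qlim p = p ^+ 2 / 2.
  by rewrite /qlim; field; lra.
have mdel : m%:R * k%:R * del = U * (m%:R * (4 / (2 * l%:R + 1))).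
  by rewrite delE// /U; ring.
(* The errors of the asymptotic values $2p$, $p^2/2$ and 0 in [sum_drift]. Since [e2] and [e3] are
   nonnegative and enter with opposite signs, only the larger bound 11 survives. *)
pose e1 := 2 * p - m%:R * (4 / (2 * l%:R + 1)).
pose e2 := m%:R * (m%:R + 1) / 2 * weight l.+1 - p ^+ 2 / 2.
pose e3 := A * del.
have -> : \sum_(r < n.+1) drift r + (2 * p - 1) * (U - qlim p) = U * e1 + e2 - e3.
  by rewrite sum_drift mdel (mulrBr (2 * p - 1) U) pql /e1 /e2 /e3; ring.
have U0 := U_ge0.
have [e1l e1u] : - (2 / l%:R) <= e1 /\ e1 <= 2 / l%:R.
  rewrite /e1; split.
  - rewrite -subr_ge0.
    have -> : 2 * p - m%:R * (4 / (2 * l%:R + 1)) - - (2 / l%:R) =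
      ((4 * p * l%:R + 2 * p - 4 * m%:R) * l%:R + 4 * l%:R + 2) / ((2 * l%:R + 1) * l%:R).
      by field; apply/andP; split; lra.
    have h : 0 <= (4 * p * l%:R + 4 - 4 * m%:R) * l%:R by rewrite mulr_ge0//; lra.
    by apply: divr_ge0; [lra|rewrite mulr_ge0//; lra].
  - rewrite -subr_ge0.
    have -> : 2 / l%:R - (2 * p - m%:R * (4 / (2 * l%:R + 1))) =
      ((4 * m%:R - 4 * p * l%:R - 2 * p) * l%:R + 4 * l%:R + 2) / ((2 * l%:R + 1) * l%:R).
      by field; apply/andP; split; lra.
    have h : 0 <= (4 * m%:R - 4 * p * l%:R) * l%:R by rewrite mulr_ge0//; lra.
    have h' : 0 <= (1 - p) * l%:R by rewrite mulr_ge0//; lra.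
    by apply: divr_ge0; [lra|rewrite mulr_ge0//; lra].
have [e2l e2u] : 0 <= e2 /\ e2 <= 3 / l%:R.
  have m0 : 0 <= m%:R :> R by [].
  have p2 : 0 <= p ^+ 2 by rewrite sqr_ge0.
  have d0 : 0 < (2 * l%:R - 1) * (2 * l%:R + 1) :> R by rewrite mulr_gt0//; lra.
  rewrite /e2 weightS; split; rewrite -subr_ge0.
  - rewrite (_ : _ - _ = (4 * ((m%:R - p * l%:R) * (m%:R + p * l%:R)) + 4 * m%:R + p ^+ 2) /
        (2 * ((2 * l%:R - 1) * (2 * l%:R + 1)))); last by field; apply/andP; split; lra.
    have h : 0 <= (m%:R - p * l%:R) * (m%:R + p * l%:R) by rewrite mulr_ge0//; lra.
    by rewrite divr_ge0//; lra.
  - have h1 : 0 <= (p * l%:R + 1 - m%:R) * (p * l%:R + 1 + m%:R + 1) * l%:R.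
      by rewrite !mulr_ge0//; lra.
    have h2 : 0 <= (1 - p) * (l%:R * l%:R) by rewrite mulr_ge0//; lra.
    have h3 : 0 <= (1 - p ^+ 2) * l%:R by rewrite mulr_ge0// subr_ge0 expr_le1//; lra.
    have h4 : 0 <= (l%:R - 2) * (l%:R - 2 + 4) :> R by rewrite mulr_ge0//; lra.
    rewrite (_ : _ - _ = (4 * ((p * l%:R + 1 - m%:R) * (p * l%:R + 1 + m%:R + 1) * l%:R) +
       12 * ((1 - p) * (l%:R * l%:R)) + (1 - p ^+ 2) * l%:R +
       12 * ((l%:R - 2) * (l%:R - 2 + 4)) + (42 - 9 * l%:R) ) /
        (2 * l%:R * ((2 * l%:R - 1) * (2 * l%:R + 1)))); last by field; apply/and3P; split; lra.
    have h5 : 0 <= (l%:R - 2) * (l%:R - 2) :> R by rewrite mulr_ge0//; lra.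
    by apply: divr_ge0; [lra|rewrite mulr_ge0//; lra].
have [e3l e3u] : 0 <= e3 /\ e3 <= 11 / l%:R.
  have d0 : 0 <= del.
    by rewrite delE// mulr_ge0 ?weight_ge0// divr_ge0//; lra.
  split; first by rewrite /e3 mulr_ge0.
  apply: (@le_trans _ _ (l%:R * l%:R * del)).
    by rewrite /e3 ler_wpM2r// (le_trans A_le)// ler_wpM2r// ler_nat.
  rewrite delE// weightE//.
  (* Expanded in powers of [l - 2], the numerator has positive coefficients only. *)
  have t0 : 0 <= l%:R - 2 :> R by lra.
  have t2 : 0 <= (l%:R - 2) * (l%:R - 2) :> R by rewrite mulr_ge0.
  have t3 : 0 <= (l%:R - 2) * ((l%:R - 2) * (l%:R - 2)) :> R by rewrite mulr_ge0.
  rewrite -subr_ge0 (_ : _ - _ = (37 + 314 * (l%:R - 2) +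
      300 * ((l%:R - 2) * (l%:R - 2)) +
      72 * ((l%:R - 2) * ((l%:R - 2) * (l%:R - 2)))) /
    (l%:R * ((2 * l%:R - 3) * ((2 * l%:R - 1) * (2 * l%:R + 1))))); last first.
    by field; apply/and4P; split; lra.
  apply: divr_ge0; first by lra.
  by rewrite mulr_ge0// mulr_ge0 ?mulr_ge0//; lra.
have Ue1l : - (2 * U / l%:R) <= U * e1.
  by rewrite (_ : - (2 * U / l%:R) = U * - (2 / l%:R)) ?ler_wpM2l//; ring.
have Ue1u : U * e1 <= 2 * U / l%:R.
  by rewrite (_ : 2 * U / l%:R = U * (2 / l%:R)) ?ler_wpM2l//; ring.
rewrite [leRHS]mulrDl ler_norml; apply/andP; split; lra.
Qed.

(** Expanding the square, the mean drift yields the contraction $2(2p-1)$; its error and the squared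
    increments make up the term of order $1/l$. *)
Lemma step_sqr : (1 < l)%N ->
  next_sum n l m k N (fun k' l' => (k'%:R * weight l' - qlim p) ^+ 2) <=
  (k%:R * weight l - qlim p) ^+ 2 * (n.+1%:R - 2 * (2 * p - 1)) +
  sqr_const * (1 + (k%:R * weight l - qlim p) ^+ 2) / l%:R.
Proof.
have [pg pl mg ml] := And4 p_gt p_le m_ge m_lt.
move=> l1; have l2 := lR2 l1; have U0 := U_ge0; rewrite -/U.
have q0 : 0 <= qlim p by exact: qlim_ge0.
set q := qlim p; set v := `|U - q|.
have -> : next_sum n l m k N (fun k' l' => (k'%:R * weight l' - q) ^+ 2) =
    (U - q) ^+ 2 * n.+1%:R + 2 * (U - q) * (\sum_(r < n.+1) drift r) +
    \sum_(r < n.+1) drift r ^+ 2.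
  transitivity (\sum_(r < n.+1)
      ((U - q) ^+ 2 + 2 * (U - q) * drift r + drift r ^+ 2)).
    by apply: eq_bigr => r _; rewrite driftE; ring.
  rewrite 2!big_split/= sumr_const card_ord -mulr_sumr.
  by rewrite -[(U - q) ^+ 2 *+ _]mulr_natr.
set S := \sum_(r < n.+1) drift r.
have v2 : (U - q) ^+ 2 = v ^+ 2 by rewrite real_normK// num_real.
have cross : 2 * (U - q) * S <=
    - 2 * (2 * p - 1) * (U - q) ^+ 2 + 2 * v * ((2 * U + 11) / l%:R).
  rewrite (_ : 2 * (U - q) * S = - 2 * (2 * p - 1) * (U - q) ^+ 2 +
    2 * ((U - q) * (S + (2 * p - 1) * (U - q)))); last by ring.
  rewrite lerD2l -mulrA ler_wpM2l// (le_trans (ler_norm _))// normrM.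
  by rewrite ler_wpM2l ?sum_drift_near.
have := sum_sqr_drift l1; set S2 := \sum_(r < n.+1) _ => S2_le.
have Uv : U <= v + q by rewrite -lerBlDr ler_norm.
have v0 : 0 <= v by exact: normr_ge0.
have big : 2 * v * (2 * U + 11) + (6 * U + (2 * U + 3) ^+ 2) <=
    sqr_const * (1 + v ^+ 2).
  have h1 : v * U <= v * (v + q) by rewrite ler_wpM2l.
  have h2 : (2 * U + 3) ^+ 2 <= (2 * (v + q) + 3) ^+ 2.
    by rewrite lerXn2r ?nnegrE//; lra.
  have h3 : 0 <= (v - 1) ^+ 2 by rewrite sqr_ge0.
  have h4 : 0 <= (2 * v - (2 * q + 3)) ^+ 2 by rewrite sqr_ge0.
  have h5 : 0 <= q * (v - 1) ^+ 2 by rewrite mulr_ge0 ?sqr_ge0.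
  have h6 : 0 <= q * v ^+ 2 by rewrite mulr_ge0 ?sqr_ge0.
  have h7 : 0 <= (2 * q + 3) ^+ 2 * v ^+ 2 by rewrite mulr_ge0 ?sqr_ge0.
  rewrite /sqr_const -/q; lra.
rewrite v2 in cross *.
have -> : sqr_const * (1 + v ^+ 2) / l%:R = (sqr_const * (1 + v ^+ 2)) / l%:R by [].
have : (2 * v * (2 * U + 11) + (6 * U + (2 * U + 3) ^+ 2)) / l%:R <=
    sqr_const * (1 + v ^+ 2) / l%:R by rewrite ler_wpM2r// invr_ge0; lra.
lra.
Qed.

End OneStep.

(** * Recursions for means over all patterns *)

Section MeanRecursions.
Context (R : realType) (p : R).
Hypotheses (p_gt : 2^-1 < p) (p_le : p <= 1).
Implicit Types (x : nat -> R) (n : nat) (A : (nat -> R) -> bool).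

Definition scaled_sum n x : R :=
  (sum_ranks x p n)%:R * weight R (nb_retained x p n).

Definition mean_inv n : R :=
  pattern_mean n (fun x => (nb_retained x p n)%:R^-1).

(** Not normalised by the probability of [A], so that means over complementary events add up. *)
Definition mean_on A n (f : (nat -> R) -> R) : R :=
  pattern_mean n (fun x => (A x)%:R * f x).

Lemma scaled_sum_ge0 n x : 0 <= scaled_sum n x.
Proof. by rewrite mulr_ge0// weight_ge0. Qed.

Lemma mean_inv_ge0 n : 0 <= mean_inv n.
Proof. by apply: pattern_mean_ge0 => s; rewrite invr_ge0. Qed.

Lemma order_invariant_scaled_sum n : order_invariant n (scaled_sum n).
Proof.
move=> x y xy; rewrite /scaled_sum (order_invariant_sum_ranks p xy).
by rewrite (order_invariant_nb_retained p xy).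
Qed.

Lemma pattern_meanZr n c (f : (nat -> R) -> R) :
  pattern_mean n (fun x => f x * c) = pattern_mean n f * c.
Proof.
rewrite [RHS]mulrC -pattern_meanZ; apply: eq_pattern_mean => s; exact: mulrC.
Qed.

Lemma nb_retained_le x n : (nb_retained x p n <= n)%N.
Proof.
elim: n => [|[_|n IH]]; first by rewrite (_ : nb_retained x p 0 = 0%N)//; exact: cardfs0.
  by rewrite /nb_retained cardfs1.
by rewrite nb_retainedS// -[leqRHS]addn1 leq_add// leq_b1.
Qed.

Lemma pattern_mean_step_le n (phi : (nat -> R) -> nat -> nat -> R)
    (B : (nat -> R) -> R) : (0 < n)%N ->
  (forall k l, order_invariant n (fun x => phi x k l)) ->
  (forall x, distinct n x ->
     next_sum n (nb_retained x p n) (threshold p (nb_retained x p n))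
       (sum_ranks x p n) (nb_ge p x n) (phi x) <= B x) ->
  pattern_mean n.+1 (fun x => phi x (sum_ranks x p n.+1) (nb_retained x p n.+1))
    <= n.+1%:R^-1 * pattern_mean n B.
Proof.
move=> n0 phi_inv phiB; rewrite (pattern_mean_step p_gt)// -pattern_meanZ.
apply: le_pattern_mean => s; rewrite ler_wpM2l ?invr_ge0//.
by apply: phiB; exact: perm_seq_distinct.
Qed.

Let recE (n : nat) (a c b : R) :
  n.+1%:R^-1 * (a * (n.+1%:R - c) + b) = a * (1 - c / n.+1%:R) + b / n.+1%:R.
Proof. by field. Qed.

Lemma mean_inv_rec n : (0 < n)%N ->
  mean_inv n.+1 <= mean_inv n * (1 - p / 2 / n.+1%:R).
Proof.
move=> n0; have -> : mean_inv n * (1 - p / 2 / n.+1%:R) = n.+1%:R^-1 *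
    pattern_mean n (fun x => (nb_retained x p n)%:R^-1 * (n.+1%:R - p / 2)).
  by rewrite pattern_meanZr -/(mean_inv n); field.
apply: (@pattern_mean_step_le n (fun _ _ l => l%:R^-1)) => // x x_inj.
apply: step_inv => //.
- exact: nb_retained_gt0.
- exact: nb_retained_le.
- exact: threshold_le.
- exact: threshold_ge.
- exact: threshold_lt.
Qed.

Lemma mean_scaled_sum_rec A n : (0 < n)%N -> order_invariant n A ->
  mean_on A n.+1 (scaled_sum n.+1) <=
  mean_on A n (scaled_sum n) * (1 - (2 * p - 1) / 3 / n.+1%:R) +
  5 * mean_on A n (fun=> 1) / n.+1%:R.
Proof.
move=> n0 A_inv.
have -> : mean_on A n (scaled_sum n) * (1 - (2 * p - 1) / 3 / n.+1%:R) +
    5 * mean_on A n (fun=> 1) / n.+1%:R = n.+1%:R^-1 *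
    pattern_mean n (fun x => (A x)%:R *
      (scaled_sum n x * (n.+1%:R - (2 * p - 1) / 3) + 5)).
  rewrite -recE; congr (_ * _); rewrite -pattern_meanZr -pattern_meanZ -pattern_meanD.
  by apply: eq_pattern_mean => s; ring.
apply: (@pattern_mean_step_le n (fun x k l => (A x)%:R * (k%:R * weight R l))) => //.
  by move=> k l x y /A_inv ->.
move=> x x_inj; rewrite /next_sum -mulr_sumr ler_wpM2l//.
apply: step_weight => //.
- exact: nb_retained_gt0.
- exact: nb_retained_le.
- exact: threshold_le.
- by apply: threshold_half => //; exact: nb_retained_gt0.
- exact: threshold_ge.
- exact: threshold_lt.
- exact: nb_ge_le.
- exact: sum_nb_ge.
- exact: sum_ranks1.
Qed.

(** On [A] the level is so high that the error term in $(U-q_p)^2$ uses up at most half of the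
    contraction $2(2p-1)$. *)
Lemma mean_sqr_rec A n : (0 < n)%N -> order_invariant n A ->
  (forall x, A x -> (1 < nb_retained x p n)%N /\
     sqr_const p <= (2 * p - 1) * (nb_retained x p n)%:R) ->
  mean_on A n.+1 (fun x => (scaled_sum n.+1 x - qlim p) ^+ 2) <=
  mean_on A n (fun x => (scaled_sum n x - qlim p) ^+ 2) *
    (1 - (2 * p - 1) / n.+1%:R) + sqr_const p * mean_inv n / n.+1%:R.
Proof.
move=> n0 A_inv AL; set W := fun x => (scaled_sum n x - qlim p) ^+ 2.
have C0 := sqr_const_ge0 p_gt.
have -> : mean_on A n W * (1 - (2 * p - 1) / n.+1%:R) +
    sqr_const p * mean_inv n / n.+1%:R = n.+1%:R^-1 *
    pattern_mean n (fun x => (A x)%:R * W x * (n.+1%:R - (2 * p - 1)) +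
       sqr_const p * (nb_retained x p n)%:R^-1).
  by rewrite -recE pattern_meanD pattern_meanZr pattern_meanZ.
apply: (@pattern_mean_step_le n
    (fun x k l => (A x)%:R * (k%:R * weight R l - qlim p) ^+ 2)) => //.
  by move=> k l x y /A_inv ->.
move=> x x_inj; rewrite /next_sum -mulr_sumr.
have l0 : (0 < (nb_retained x p n)%:R :> R) by rewrite ltr0n; exact: nb_retained_gt0.
case: (boolP (A x)) => [/AL[l1 lC]|_]; last first.
  by rewrite !mul0r add0r divr_ge0// ltW.
rewrite !mul1r; apply: le_trans.
  apply: (step_sqr p_gt p_le) => //.
  - exact: nb_retained_gt0.
  - exact: nb_retained_le.
  - exact: threshold_le.
  - exact: threshold_ge.
  - exact: threshold_lt.
  - exact: nb_ge_le.
  - exact: sum_nb_ge.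
rewrite -/(scaled_sum n x) -/(W x).
have W0 : 0 <= W x by exact: sqr_ge0.
have : sqr_const p / (nb_retained x p n)%:R <= 2 * p - 1 by rewrite ler_pdivrMr.
set c := _ / _ => c_le.
have : c * W x <= (2 * p - 1) * W x by rewrite ler_wpM2r.
rewrite (_ : sqr_const p * (1 + W x) / _ = c + c * W x); last by rewrite /c; ring.
lra.
Qed.

Lemma mean_affine_rec n (f : (nat -> R) -> nat -> R) : (0 < n)%N ->
  (forall l, order_invariant n (f^~ l)) ->
  pattern_mean n.+1 (fun x => f x (nb_retained x p n.+1)) =
  pattern_mean n (fun x => f x (nb_retained x p n)) +
  pattern_mean n (fun x => (threshold p (nb_retained x p n))%:R *
    (f x (nb_retained x p n).+1 - f x (nb_retained x p n))) / n.+1%:R.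
Proof.
move=> n0 f_inv.
rewrite (@pattern_mean_step _ _ p_gt _ (fun x _ l => f x l))//.
rewrite -pattern_meanZr -pattern_meanD.
apply: eq_pattern_mean => s.
set x := perm_seq R s.
have /= := @step_count R n (nb_retained x p n) _ (sum_ranks x p n) (nb_ge p x n)
  (nb_retained_le _ _) (threshold_le p_gt p_le _) (f x).
rewrite /next_sum => ->.
by field.
Qed.

(* The factorial moments of the increments are at most those of the Polya urn
   obtained by replacing the threshold [ceil (p L)] with [L]. *)
Lemma mean_sqr_growth N n : (0 < N)%N -> (N <= n)%N ->
  let t := (n%:R - N%:R) / N.+1%:R in
  pattern_mean n (fun x => (((nb_retained x p n)%:R - (nb_retained x p N)%:R) /
     (nb_retained x p N)%:R) ^+ 2) <= 2 * t ^+ 2 + t * mean_inv N.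
Proof.
move=> N0 Nn.
pose a x : R := (nb_retained x p N)%:R.
have a1 x : 1 <= a x by rewrite ler1n; exact: nb_retained_gt0.
have a_inv j : (N <= j)%N -> order_invariant j a.
  by move=> Nj x y /(same_orderW Nj) xy; rewrite /a (order_invariant_nb_retained p xy).
(* The solution of $T_{j+1} = T_j + (1 + T_j)/(j+1)$ with $T_N = 0$, the mean relative growth in the
   urn. *)
pose T j : R := (j%:R - N%:R) / N.+1%:R.
have TS j : T j.+1 = T j + N.+1%:R^-1 by rewrite /T -natr1; field.
have jE (j : nat) : j.+1%:R = N.+1%:R * (1 + T j) :> R.
  by rewrite /T -!natr1; field; rewrite natr1.
have T0 j : (N <= j)%N -> 0 <= T j by move=> Nj; rewrite divr_ge0// subr_ge0 ler_nat.
pose D x j : R := (nb_retained x p j)%:R - a x.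
have D0 x j : (N <= j)%N -> 0 <= D x j.
  by move=> Nj; rewrite subr_ge0 ler_nat; exact: nb_retained_homo.
have m_le x j : (threshold p (nb_retained x p j))%:R <= D x j + a x.
  by rewrite subrK ler_nat threshold_le.
have const_inv (c : (nat -> R) -> R) j : order_invariant N c -> (N <= j)%N ->
    pattern_mean j c = pattern_mean N c.
  move=> c_inv; elim: j => [|j IH]; first by rewrite leqn0 => /eqP <-.
  rewrite leq_eqVlt => /orP[/eqP <-//|]; rewrite ltnS => Nj.
  by rewrite pattern_mean_const ?IH//; exact: order_invariantW c_inv.
have first_moment (c : (nat -> R) -> R) j : order_invariant N c ->
    (forall x, 0 <= c x) -> (N <= j)%N ->
    pattern_mean j (fun x => D x j * c x) <= pattern_mean N (fun x => a x * c x) * T j.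
  move=> c_inv c0; elim: j => [|j IH].
    by rewrite leqn0 => N_0; rewrite (eqP N_0) in N0.
  rewrite leq_eqVlt => /orP[/eqP <-|].
    rewrite /T subrr mul0r mulr0 le_eqVlt; apply/orP; left; apply/eqP.
    rewrite -[RHS](pattern_mean_cst N 0); apply: eq_pattern_mean => s.
    by rewrite /D subrr mul0r.
  rewrite ltnS => Nj; have j0 : (0 < j)%N by exact: leq_trans Nj.
  have cj := order_invariantW Nj c_inv.
  rewrite (@mean_affine_rec j (fun x l => (l%:R - a x) * c x))//; last first.
    by move=> l x y xy; rewrite (a_inv _ Nj _ _ xy) (cj _ _ xy).
  set ac := pattern_mean N _.
  have acE : pattern_mean j (fun x => a x * c x) = ac.
    by apply: const_inv => // x y xy; rewrite (a_inv N (leqnn _) _ _ xy) (c_inv _ _ xy).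
  have incr : pattern_mean j (fun x => (threshold p (nb_retained x p j))%:R *
      (((nb_retained x p j).+1%:R - a x) * c x - ((nb_retained x p j)%:R - a x) * c x))
      <= pattern_mean j (fun x => D x j * c x) + ac.
    rewrite -acE -pattern_meanD; apply: le_pattern_mean => s.
    set x := perm_seq R s; rewrite -mulrBl -natr1.
    have -> : (nb_retained x p j)%:R + 1 - a x - ((nb_retained x p j)%:R - a x) = 1.
      by ring.
    by rewrite mul1r -mulrDl ler_wpM2r.
  have ac0 : 0 <= ac.
    by apply: pattern_mean_ge0 => s; rewrite mulr_ge0// (le_trans _ (a1 _)).
  apply: (@le_trans _ _ (ac * T j + (ac * T j + ac) / j.+1%:R)).
    by rewrite lerD ?IH// ler_wpM2r ?invr_ge0// (le_trans incr)// lerD2r IH.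
  rewrite TS (jE j) le_eqVlt; apply/orP; left; apply/eqP; field.
  by have := T0 j Nj => Tj0; apply/andP; split => //; lra.
have d_le j : (N <= j)%N -> pattern_mean j (fun x => D x j * (a x ^- 2)) <= mean_inv N * T j.
  move=> Nj; have -> : mean_inv N = pattern_mean N (fun x => a x * (a x ^- 2)).
    apply: eq_pattern_mean => s; rewrite -/(a _); have := a1 (perm_seq R s) => as1.
    by field; lra.
  apply: first_moment => //.
    by move=> x y xy; rewrite (a_inv _ _ _ _ xy).
  by move=> x; rewrite invr_ge0 sqr_ge0.
have g_le j : (N <= j)%N ->
    pattern_mean j (fun x => D x j * ((a x + 1) * a x ^- 2)) <= 2 * T j.
  move=> Nj; apply: le_trans (first_moment _ _ _ _ Nj) _.
  - by move=> x y xy; rewrite (a_inv _ _ _ _ xy).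
  - by move=> x; rewrite mulr_ge0 ?invr_ge0 ?sqr_ge0//; have := a1 x; lra.
  rewrite ler_wpM2r ?T0// -[leRHS](pattern_mean_cst N); apply: le_pattern_mean => s.
  have := a1 (perm_seq R s); set b := a _ => b1.
  rewrite (_ : b * _ = (b + 1) / b); last by field; lra.
  by rewrite ler_pdivrMr; lra.
have b_le j : (N <= j)%N ->
    pattern_mean j (fun x => D x j * (D x j - 1) * a x ^- 2) <= 2 * T j ^+ 2.
  elim: j => [|j IH].
    by rewrite leqn0 => N_0; rewrite (eqP N_0) in N0.
  rewrite leq_eqVlt => /orP[/eqP <-|].
    rewrite /T subrr mul0r expr0n mulr0 le_eqVlt; apply/orP; left; apply/eqP.
    rewrite -[RHS](pattern_mean_cst N 0); apply: eq_pattern_mean => s.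
    by rewrite /D subrr !mul0r.
  rewrite ltnS => Nj; have j0 : (0 < j)%N by exact: leq_trans Nj.
  rewrite (@mean_affine_rec j
    (fun x l => (l%:R - a x) * (l%:R - a x - 1) * a x ^- 2))//; last first.
    by move=> l x y xy; rewrite (a_inv _ Nj _ _ xy).
  (* One more item raises $D(D-1)$ by $2D$, and $(D+a)D = D(D-1) + (a+1)D$ closes the recursion. *)
  have incr : pattern_mean j (fun x => (threshold p (nb_retained x p j))%:R *
      (((nb_retained x p j).+1%:R - a x) * ((nb_retained x p j).+1%:R - a x - 1) * a x ^- 2 -
       ((nb_retained x p j)%:R - a x) * ((nb_retained x p j)%:R - a x - 1) * a x ^- 2))
      <= 2 * pattern_mean j (fun x => D x j * (D x j - 1) * a x ^- 2) +
         2 * pattern_mean j (fun x => D x j * ((a x + 1) * a x ^- 2)).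
    rewrite -!pattern_meanZ -pattern_meanD; apply: le_pattern_mean => s.
    set x := perm_seq R s; rewrite -natr1.
    have -> : ((nb_retained x p j)%:R + 1 - a x) *
         ((nb_retained x p j)%:R + 1 - a x - 1) * a x ^- 2 -
         ((nb_retained x p j)%:R - a x) * ((nb_retained x p j)%:R - a x - 1) * a x ^- 2 =
         2 * D x j * a x ^- 2 by rewrite /D; ring.
    have -> : 2 * (D x j * (D x j - 1) * a x ^- 2) +
        2 * (D x j * ((a x + 1) * a x ^- 2)) = (D x j + a x) * (2 * D x j * a x ^- 2).
      by ring.
    by rewrite ler_wpM2r// !mulr_ge0 ?invr_ge0 ?sqr_ge0 ?D0.
  apply: (@le_trans _ _ (2 * T j ^+ 2 + (2 * (2 * T j ^+ 2) + 2 * (2 * T j)) / j.+1%:R)).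
    rewrite lerD ?IH// ler_wpM2r ?invr_ge0// (le_trans incr)//.
    by rewrite lerD// ler_wpM2l// ?IH// g_le.
  have Tj0 := T0 j Nj; rewrite TS (jE j) -subr_ge0.
  rewrite (_ : _ - _ = 2 * (N.+1%:R^-1) ^+ 2) ?mulr_ge0 ?sqr_ge0//.
  by field; apply/andP; split => //; lra.
rewrite -/(T n) /=.
have -> : pattern_mean n (fun x => (((nb_retained x p n)%:R - (nb_retained x p N)%:R) /
     (nb_retained x p N)%:R) ^+ 2) =
   pattern_mean n (fun x => D x n * (D x n - 1) * a x ^- 2) +
   pattern_mean n (fun x => D x n * (a x ^- 2)).
  rewrite -pattern_meanD; apply: eq_pattern_mean => s.
  by rewrite -/(a _) -/(D _ _) expr_div_n; ring.
by rewrite lerD ?b_le// mulrC d_le.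
Qed.

End MeanRecursions.

(** * Polynomial decay and summability *)

Section Decay.
Context (R : realType).
Implicit Types (a : nat -> R) (c d b K : R) (n k : nat).

Definition decay d n : R := n.+1%:R `^ (- d).

Lemma decay_gt0 d n : 0 < decay d n.
Proof. by rewrite powR_gt0. Qed.

(** With $u = 1/(n+1)$: $(1+u)^{-d} \ge e^{-du} \ge 1 - du$. *)
Lemma decay_rec d n : 0 <= d -> decay d n * (1 - d / n.+1%:R) <= decay d n.+1.
Proof.
move=> d0; have u0 : 0 < n.+1%:R^-1 :> R by rewrite invr_gt0.
rewrite /decay (_ : n.+2%:R = n.+1%:R * (1 + n.+1%:R^-1) :> R); last first.
  by rewrite -[n.+2%:R]natr1; field.
rewrite powRM//.
rewrite ler_wpM2l ?powR_ge0// {1}/powR gt_eqF ?addr_gt0//.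
apply: le_trans (expR_ge1Dx _); rewrite lerD2l mulNr lerN2 ler_wpM2l//.
by apply: le_ln1Dx; rewrite (lt_trans _ u0)// ltrN10.
Qed.

Lemma decay_bound a c d b (N : nat) : 0 <= d -> d < c -> c <= 1 -> 0 <= b ->
  (forall n, (N <= n)%N ->
     a n.+1 <= a n * (1 - c / n.+1%:R) + b * decay d n / n.+1%:R) ->
  exists2 K, 0 <= K & forall n, (N <= n)%N -> a n <= K * decay d n.
Proof.
move=> d0 dc c1 b0 a_rec.
(* The first summand lets the gap [c - d] between the two rates absorb the forcing term; the second
   covers the initial value. *)
pose K := b / (c - d) + `|a N| / decay d N.
have cd0 : 0 < c - d by rewrite subr_gt0.
have bK : b <= (c - d) * K.
  rewrite /K mulrDr mulrCA divff ?gt_eqF// mulr1 lerDl mulr_ge0 ?(ltW cd0)//.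
  by rewrite divr_ge0// ltW// decay_gt0.
exists K.
  by rewrite /K addr_ge0// divr_ge0// ltW// decay_gt0.
elim=> [|n IH].
  rewrite leqn0 => /eqP N0; rewrite -N0 /K mulrDl divfK ?gt_eqF ?decay_gt0//.
  rewrite (le_trans (ler_norm _))// lerDr mulr_ge0 ?(ltW (decay_gt0 _ _))//.
  by rewrite divr_ge0// ltW.
rewrite leq_eqVlt => /orP[/eqP <-|].
  rewrite /K mulrDl divfK ?gt_eqF ?decay_gt0//.
  rewrite (le_trans (ler_norm _))// lerDr mulr_ge0 ?(ltW (decay_gt0 _ _))//.
  by rewrite divr_ge0// ltW.
rewrite ltnS => Nn; apply: le_trans (a_rec _ Nn) _.
have K0 : 0 <= K by rewrite /K addr_ge0// divr_ge0// ltW// decay_gt0.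
have n1 : 0 < n.+1%:R^-1 :> R by rewrite invr_gt0.
have n1' : n.+1%:R^-1 <= 1 :> R by rewrite invf_le1// ler1n.
have cn : 0 <= 1 - c / n.+1%:R.
  by rewrite subr_ge0 mulr_ile1//; lra.
apply: (@le_trans _ _ (K * (decay d n * (1 - d / n.+1%:R)))); last first.
  by rewrite ler_wpM2l// decay_rec.
have h1 : a n * (1 - c / n.+1%:R) <= K * decay d n * (1 - c / n.+1%:R).
  by rewrite ler_wpM2r// IH.
have h2 : b * decay d n / n.+1%:R <= (c - d) * K * decay d n / n.+1%:R.
  by rewrite ler_wpM2r ?(ltW n1)// ler_wpM2r ?(ltW (decay_gt0 _ _)).
apply: le_trans (lerD h1 h2) _; rewrite le_eqVlt; apply/orP; left; apply/eqP; ring.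
Qed.

Lemma decay_bound0 a c (N : nat) : 0 < c -> c <= 1 ->
  (forall n, (N <= n)%N -> a n.+1 <= a n * (1 - c / n.+1%:R)) ->
  exists2 K, 0 <= K & forall n, (N <= n)%N -> a n <= K * decay (c / 2) n.
Proof.
move=> c0 c1 a_rec; apply: (@decay_bound a c _ 0) => //; [lra..|].
by move=> n Nn; rewrite mul0r mul0r addr0 a_rec.
Qed.

Lemma decay_subseq d (e : nat) k : 2 <= d * e%:R ->
  decay d (k.+1 ^ e) <= k.+1%:R ^- 2.
Proof.
move=> de; have d0 : 0 <= d.
  rewrite leNgt; apply/negP => dneg.
  have : d * e%:R <= 0 by rewrite mulr_le0_ge0// ltW.
  lra.
rewrite /decay powRN lef_pV2 ?posrE ?exprn_gt0 ?powR_gt0//.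
apply: (@le_trans _ _ ((k.+1 ^ e)%:R `^ d)); last first.
  by apply: ge0_ler_powR; rewrite ?nnegrE// ler_nat.
rewrite natrX -powR_mulrn// -powRrM mulrC -powR_mulrn//.
by apply: ler_powR => //; rewrite ler1n.
Qed.

Lemma cvg_decay d : 0 < d -> decay d n @[n --> \oo] --> 0.
Proof.
move=> d0; apply/cvgrPdist_le => /= eps eps0.
have [e de] : exists e : nat, 2 <= d * e%:R.
  exists (Num.bound (2 / d)); rewrite mulrC -ler_pdivrMr// ltW//.
  by rewrite archi_boundP// divr_ge0// ltW.
have [k k_eps] : exists k : nat, k.+1%:R ^- 2 <= eps.
  exists (Num.bound eps^-1); set k := Num.bound _.
  have epsk : eps^-1 < k%:R.
    by rewrite archi_boundP// invr_ge0 ltW.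
  rewrite invf_ple ?posrE ?exprn_gt0// expr2.
  have k1 : 1 <= k.+1%:R :> R by rewrite ler1n.
  rewrite (le_trans (ltW epsk))// (le_trans (_ : _ <= k.+1%:R)) ?ler_nat//.
  by rewrite ler_peMr.
exists (k.+1 ^ e)%N => // n /= kn.
rewrite sub0r normrN ger0_norm ?(ltW (decay_gt0 _ _))//.
apply: le_trans k_eps; apply: le_trans (decay_subseq k de).
rewrite /decay !powRN lef_pV2 ?posrE ?powR_gt0//.
by apply: ge0_ler_powR; rewrite ?nnegrE ?(ltW d0)// ler_nat ltnS.
Qed.

(** With $u = 1/(k+1) \le 1$, $(1+u)^e - 1$ lies below its chord $(2^e - 1)u$. *)
Lemma pow_step_ratio (e k : nat) :
  (((k.+2 ^ e)%:R - (k.+1 ^ e)%:R) / (k.+1 ^ e).+1%:R : R) <= (2 ^ e)%:R / k.+1%:R.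
Proof.
pose u : R := k.+1%:R^-1.
have u0 : 0 < u by rewrite invr_gt0.
have u1 : u <= 1 by rewrite invf_le1// ler1n.
have bin (j : nat) : (1 + u) ^+ j - 1 <= (2 ^+ j - 1) * u.
  elim: j => [|j IH]; first by rewrite !expr0 !subrr mul0r.
  have p1 : 1 <= 2 ^+ j :> R by rewrite exprn_ege1// ler1n.
  have h : 0 <= (2 ^+ j - 1) * u * (1 - u) by rewrite !mulr_ge0 ?(ltW u0)//; lra.
  have h' : 0 <= ((2 ^+ j - 1) * u - ((1 + u) ^+ j - 1)) * (1 + u).
    by rewrite mulr_ge0//; lra.
  by rewrite !exprS; lra.
have kE : k.+2%:R = k.+1%:R * (1 + u) :> R by rewrite /u -[k.+2%:R]natr1; field.
rewrite !natrX kE exprMn.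
have K0 : 0 <= (k.+1%:R : R) ^+ e by rewrite exprn_ge0.
rewrite ler_pdivrMr// -[(k.+1 ^ e).+1%:R]natr1 natrX.
have num : k.+1%:R ^+ e * (1 + u) ^+ e - k.+1%:R ^+ e <= (2 ^+ e * u) * k.+1%:R ^+ e.
  rewrite (_ : _ - _ = ((1 + u) ^+ e - 1) * k.+1%:R ^+ e); last by ring.
  by rewrite ler_wpM2r// (le_trans (bin e))//; lra.
rewrite (le_trans num)// -/u.
have : 0 <= 2 ^+ e * u by rewrite mulr_ge0 ?(ltW u0)// exprn_ge0.
lra.
Qed.

Lemma sum_inv_sqr n : \sum_(k < n) (k.+1%:R ^- 2 : R) <= 2.
Proof.
(* Strengthened by the telescoping term so that induction goes through. *)
suff : \sum_(k < n.+1) (k.+1%:R ^- 2 : R) <= 2 - n.+1%:R^-1.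
  have n0 : 0 < n.+1%:R^-1 :> R by rewrite invr_gt0.
  have t0 : 0 <= n.+1%:R ^- 2 :> R by rewrite invr_ge0 sqr_ge0.
  rewrite big_ord_recr/= => h; apply: le_trans (le_trans _ h) _.
    by rewrite lerDl.
  by rewrite gerBl ltW.
elim: n => [|n IH]; first by rewrite big_ord1/= expr1n; lra.
rewrite big_ord_recr/= (le_trans (lerD IH (lexx _)))//.
rewrite -[n.+2%:R]natr1 -subr_ge0.
have : 0 < n.+1%:R :> R by [].
move: (n.+1%:R) => x x0; rewrite (_ : _ - _ = x^-1 * (x + 1) ^- 2).
  by rewrite mulr_ge0// invr_ge0 ?sqr_ge0// ltW.
by field; apply/andP; split; lra.
Qed.

End Decay.

(** * Decay of the means and convergence of the expectations *)

Section MeanLimits.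
Context (R : realType) (p : R).
Hypotheses (p_gt : 2^-1 < p) (p_le : p <= 1).
Implicit Types (x : nat -> R) (n N : nat).

(** One exponent below both contraction rates, [p / 2] for [mean_inv] and [2 * p - 1] for the mean
    square. *)
Local Notation rate := ((2 * p - 1) / 4).

Let rate_gt0 : 0 < rate.
Proof. have pg := p_gt; by rewrite divr_gt0//; lra. Qed.

Lemma mean_inv_decay : exists2 K, 0 <= K &
  forall n, (0 < n)%N -> mean_inv p n <= K * decay rate n.
Proof.
have [pg pl] := conj p_gt p_le.
apply: (@decay_bound _ _ (p / 2) _ 0); [exact: ltW|lra|lra|by []|].
by move=> n n0; rewrite mul0r mul0r addr0 mean_inv_rec.
Qed.

Lemma cvg_mean_inv : mean_inv p n @[n --> \oo] --> 0.
Proof.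
have [K K0 Kle] := mean_inv_decay.
apply: (@squeeze_cvgr _ _ _ _ (fun=> 0) (fun n => K * decay rate n)).
- near=> n; rewrite mean_inv_ge0 Kle//; near: n; exact: nbhs_infty_gt.
- exact: cvg_cst.
- by rewrite -[X in _ --> X](mulr0 K); apply: cvgM; [exact: cvg_cst|exact: cvg_decay].
Unshelve. all: by end_near. Qed.

(** High enough for [mean_sqr_rec]; the two successors ensure a level of at least 2. *)
Definition level : nat := (Num.bound (sqr_const p / (2 * p - 1))).+2.

Lemma le_level (l : nat) : (level <= l)%N ->
  (1 < l)%N /\ sqr_const p <= (2 * p - 1) * l%:R.
Proof.
have pg := p_gt; move=> ll; split; first exact: leq_trans ll.
rewrite mulrC -ler_pdivrMr; last by lra.
apply: (@le_trans _ _ level%:R); last by rewrite ler_nat.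
have b0 : 0 <= sqr_const p / (2 * p - 1) by rewrite divr_ge0 ?(sqr_const_ge0 p_gt)//; lra.
by rewrite (le_trans (ltW (archi_boundP b0)))// ler_nat; apply/leqW/leqW.
Qed.

Lemma order_invariant_level N n : (N <= n)%N ->
  order_invariant n (fun x => (level <= nb_retained x p N)%N).
Proof.
by move=> Nn x y /(same_orderW Nn) xy; rewrite (order_invariant_nb_retained p xy).
Qed.

Lemma mean_sqr_decay N : (0 < N)%N -> exists2 K, 0 <= K & forall n, (N <= n)%N ->
  mean_on (fun x => (level <= nb_retained x p N)%N) n
    (fun x => (scaled_sum p n x - qlim p) ^+ 2) <= K * decay rate n.
Proof.
have [pg pl] := conj p_gt p_le.
move=> N0; have [K K0 Kle] := mean_inv_decay.
apply: (@decay_bound _ _ (2 * p - 1) _ (sqr_const p * K)).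
- exact: ltW.
- lra.
- lra.
- by rewrite mulr_ge0// (sqr_const_ge0 p_gt).
move=> n Nn; have n0 : (0 < n)%N by exact: leq_trans Nn.
apply: le_trans (mean_sqr_rec p_gt p_le n0 (order_invariant_level Nn) _) _.
  by move=> x lx; apply: le_level; rewrite (leq_trans lx)// nb_retained_homo.
rewrite lerD2l ler_wpM2r// -mulrA ler_wpM2l ?(sqr_const_ge0 p_gt)//.
exact: Kle.
Qed.

(** Markov's inequality for $1/L_N$; the event is decided at time [N], so its mean does not change
    with [n]. *)
Lemma mean_low_level N n : (0 < N)%N -> (N <= n)%N ->
  mean_on (fun x => (nb_retained x p N < level)%N) n (fun=> 1) <=
  level%:R * mean_inv p N.
Proof.
move=> N0; elim: n => [|n IH]; first by rewrite leqn0 => /eqP N_0; rewrite N_0 in N0.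
rewrite leq_eqVlt => /orP[/eqP <-|].
  rewrite -pattern_meanZ; apply: le_pattern_mean => s; rewrite mulr1.
  set l := nb_retained _ p N.
  have l0 : 0 < l%:R :> R by rewrite ltr0n; exact: nb_retained_gt0.
  case: ltnP => ll; last by rewrite mulr_ge0// invr_ge0.
  by rewrite ler_pdivlMr// mul1r ler_nat ltnW.
rewrite ltnS => Nn; rewrite /mean_on pattern_mean_const ?IH//.
by move=> x y /(same_orderW Nn) xy; rewrite (order_invariant_nb_retained p xy).
Qed.

(** The first term is made small by the choice of [N], uniformly in [n]; the second vanishes as [n]
    grows. *)
Lemma mean_scaled_sum_low_level N : (0 < N)%N -> exists2 K, 0 <= K &
  forall n, (N <= n)%N ->
    mean_on (fun x => (nb_retained x p N < level)%N) n (scaled_sum p n) <=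
    15 / (2 * p - 1) * (level%:R * mean_inv p N) + K * decay ((2 * p - 1) / 3 / 2) n.
Proof.
have [pg pl] := conj p_gt p_le.
move=> N0; set B := level%:R * _.
(* Subtracting the fixed point $5B / ((2p-1)/3)$ makes the recursion homogeneous. *)
pose u n := mean_on (fun x => (nb_retained x p N < level)%N) n (scaled_sum p n) -
  15 / (2 * p - 1) * B.
have [||n Nn|K K0 Kle] := @decay_bound0 _ u ((2 * p - 1) / 3) N.
- by lra.
- by lra.
- rewrite /u; have n0 : (0 < n)%N by exact: leq_trans Nn.
  have A_inv : order_invariant n (fun x => (nb_retained x p N < level)%N).
    by move=> x y /(same_orderW Nn) xy; rewrite (order_invariant_nb_retained p xy).
  have := mean_scaled_sum_rec p_gt p_le n0 A_inv.
  have : 5 * mean_on (fun x => (nb_retained x p N < level)%N) n (fun=> 1) / n.+1%:R <=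
     5 * B / n.+1%:R by rewrite ler_wpM2r// ler_wpM2l// mean_low_level.
  set m0 := mean_on _ _ _; set m1 := mean_on _ _ _; set m2 := mean_on _ _ _.
  move=> h1 h2; rewrite lerBlDr (le_trans h2)// (le_trans (lerD (lexx _) h1))//.
  rewrite le_eqVlt; apply/orP; left; apply/eqP; field.
  by apply/andP; split => //; lra.
by exists K => // n Nn; rewrite -lerBlDl; exact: Kle.
Qed.

Lemma V_scaled_sum n x : (0 < n)%N ->
  `|V x p n - scaled_sum p n x| <= 2 * scaled_sum p n x / (nb_retained x p n)%:R.
Proof.
move=> n0; rewrite /V /scaled_sum /weight.
set l := nb_retained x p n; set k : R := (sum_ranks x p n)%:R.
have k0 : 0 <= k by [].
have lR : 1 <= l%:R :> R by rewrite ler1n; exact: nb_retained_gt0.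
case: leqP => l1.
  have -> : l = 1%N by apply/eqP; rewrite eqn_leq l1 nb_retained_gt0.
  by rewrite expr1n !divr1 mulr1 subrr normr0; lra.
have l2 : 2 <= l%:R :> R by rewrite (ler_nat R 2).
have l3 : 0 < (2 * l%:R - 3) * (2 * l%:R - 1) :> R by rewrite mulr_gt0//; lra.
rewrite (_ : _ - _ = - (k * (4 / ((2 * l%:R - 3) * (2 * l%:R - 1))) *
    ((2 - 3 / (4 * l%:R)) / l%:R))); last by field; apply/and3P; split; lra.
set U := k * (4 / _).
have U0 : 0 <= U by rewrite mulr_ge0// divr_ge0// ltW.
have l34 : 0 <= 3 / (4 * l%:R) :> R by rewrite divr_ge0//; lra.
have l34' : 3 / (4 * l%:R) <= 2 :> R by rewrite ler_pdivrMr; lra.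
rewrite normrN ger0_norm; last by rewrite mulr_ge0// divr_ge0//; lra.
rewrite (_ : 2 * U / l%:R = U * (2 / l%:R)); last by ring.
by rewrite ler_wpM2l// ler_wpM2r ?invr_ge0//; lra.
Qed.

(** In the error $2U/L$ of [V_scaled_sum], $U \le |U - q_p| + q_p$ and $1/L \le 1$ in front of the
    first part. *)
Lemma dist_mean_V n x : (0 < n)%N ->
  `|V x p n - qlim p| <=
  3 * `|scaled_sum p n x - qlim p| + 2 * qlim p * (nb_retained x p n)%:R^-1.
Proof.
move=> n0; have q0 := qlim_ge0 p_gt.
have l1 : 1 <= (nb_retained x p n)%:R :> R by rewrite ler1n; exact: nb_retained_gt0.
have := V_scaled_sum x n0.
move: (scaled_sum p n x) (V x p n) => u v uv.
set i := (nb_retained x p n)%:R^-1 in uv *.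
have i0 : 0 <= i by rewrite invr_ge0; lra.
have i1 : i <= 1 by rewrite invf_le1//; lra.
have tri : `|v - qlim p| <= `|v - u| + `|u - qlim p|.
  by rewrite (le_trans _ (ler_normD _ _))// subrKA.
have ui : u * i <= `|u - qlim p| + qlim p * i.
  rewrite -lerBlDr -mulrBl (le_trans (ler_norm _))// normrM (ger0_norm i0).
  by rewrite ler_piMr.
lra.
Qed.

Lemma cvg_mean_V : pattern_mean n (fun x => V x p n) @[n --> \oo] --> qlim p.
Proof.
have [pg pl] := conj p_gt p_le; have q0 := qlim_ge0 p_gt.
set q := qlim p in q0 *; set c := 15 / (2 * p - 1).
have c0 : 0 <= c by rewrite divr_ge0//; lra.
apply/cvgrPdist_le => /= e e0.
(* The final budget is $3 \cdot 4h + h$. The time [N] is fixed first, to make the low-level event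
   negligible; only then is [n] taken large. *)
pose h := e / 13; have h0 : 0 < h by rewrite divr_gt0.
have [N N0 hN] : exists2 N, (0 < N)%N & (c + q) * (level%:R * mean_inv p N) <= h.
  have cvg0 : (c + q) * (level%:R * mean_inv p N) @[N --> \oo] --> 0.
    rewrite -[X in _ --> X](mulr0 (c + q)); apply: cvgM; first exact: cvg_cst.
    rewrite -[X in _ --> X](mulr0 level%:R); apply: cvgM; first exact: cvg_cst.
    exact: cvg_mean_inv.
  have /cvgrPdist_le /(_ h h0) [N _ hN] := cvg0.
  exists N.+1 => //; have /= := hN N.+1 (leqnSn N).
  by rewrite sub0r normrN; apply: le_trans; exact: ler_norm.
have [K1 K10 sqr_le] := mean_sqr_decay N0.
have [K2 K20 low_le] := mean_scaled_sum_low_level N0.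
have cvgK (K r g : R) : 0 < r -> 0 < g -> \forall n \near \oo, K * decay r n <= g.
  move=> r0 g0; have cvg0 : K * decay r n @[n --> \oo] --> 0.
    by rewrite -[X in _ --> X](mulr0 K); apply: cvgM; [exact: cvg_cst|exact: cvg_decay].
  have /cvgrPdist_le /(_ g g0) := cvg0; apply: filterS => n.
  by rewrite sub0r normrN; apply: le_trans; exact: ler_norm.
have inv_small : \forall n \near \oo, 2 * q * mean_inv p n <= h.
  have cvg0 : 2 * q * mean_inv p n @[n --> \oo] --> 0.
    rewrite -[X in _ --> X](mulr0 (2 * q)); apply: cvgM; first exact: cvg_cst.
    exact: cvg_mean_inv.
  have /cvgrPdist_le /(_ h h0) := cvg0; apply: filterS => n.
  by rewrite sub0r normrN; apply: le_trans; exact: ler_norm.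
near=> n.
have Nn : (N <= n)%N by near: n; exact: nbhs_infty_ge.
have n0 : (0 < n)%N by exact: leq_trans Nn.
have hK1 : K1 * decay rate n <= h ^+ 2 by near: n; apply: cvgK; rewrite ?exprn_gt0.
have hK2 : K2 * decay ((2 * p - 1) / 3 / 2) n <= h.
  by near: n; apply: cvgK => //; rewrite !divr_gt0//; lra.
have hz : 2 * q * mean_inv p n <= h by near: n.
pose A x := (level <= nb_retained x p N)%N.
pose B x := (nb_retained x p N < level)%N.
have onA : mean_on A n (fun x => `|scaled_sum p n x - q|) <= h + h.
  (* The elementary bound $|v| \le h + v^2/h$ replaces the Cauchy-Schwarz inequality. *)
  apply: (@le_trans _ _ (h + mean_on A n (fun x => (scaled_sum p n x - q) ^+ 2) / h)).
    rewrite /mean_on -pattern_meanZr -[X in X + _](pattern_mean_cst n) -pattern_meanD.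
    apply: le_pattern_mean => s; case: (A _); last by rewrite !mul0r addr0 ltW.
    rewrite !mul1r; set v := _ - q.
    rewrite -subr_ge0 (_ : _ - _ = ((`|v| - h) ^+ 2 + `|v| * h) / h).
      apply: divr_ge0; last exact: ltW.
      by apply: addr_ge0; [exact: sqr_ge0|apply: mulr_ge0 => //; exact: ltW].
    rewrite -[v ^+ 2]real_normK ?num_real//; field; exact: lt0r_neq0.
  rewrite lerD2l ler_pdivrMr// -expr2; apply: le_trans hK1; exact: sqr_le.
have onB : mean_on B n (fun x => `|scaled_sum p n x - q|) <= h + h.
  apply: (@le_trans _ _ (mean_on B n (scaled_sum p n) + q * mean_on B n (fun=> 1))).
    rewrite /mean_on -pattern_meanZ -pattern_meanD; apply: le_pattern_mean => s.
    rewrite mulr1 [q * _]mulrC -mulrDr ler_wpM2l// (le_trans (ler_normB _ _))//.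
    by rewrite (ger0_norm q0) ger0_norm ?scaled_sum_ge0.
  have := low_le n Nn; have := mean_low_level N0 Nn.
  rewrite -/B -/c; set P0 := mean_on B n (fun=> 1); set P1 := mean_on B n _ => P0le P1le.
  have : q * P0 <= q * (level%:R * mean_inv p N) by rewrite ler_wpM2l.
  have := hN; rewrite mulrDl; lra.
have dist_U : pattern_mean n (fun x => `|scaled_sum p n x - q|) <= 4 * h.
  have -> : pattern_mean n (fun x => `|scaled_sum p n x - q|) =
     mean_on A n (fun x => `|scaled_sum p n x - q|) +
     mean_on B n (fun x => `|scaled_sum p n x - q|).
    rewrite -pattern_meanD; apply: eq_pattern_mean => s.
    by rewrite /A /B ltnNge; case: leqP => _; rewrite ?mul1r ?mul0r ?addr0 ?add0r.
  lra.
have dist_V : `|pattern_mean n (fun x => V x p n) - q| <=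
    3 * pattern_mean n (fun x => `|scaled_sum p n x - q|) + 2 * q * mean_inv p n.
  rewrite -pattern_meanZ -pattern_meanZ -pattern_meanD -[X in _ - X](pattern_mean_cst n q).
  have -> : pattern_mean n (fun x => V x p n) - pattern_mean n (fun=> q) =
      pattern_mean n (fun x => V x p n - q).
    rewrite -[X in _ + X]mulN1r -pattern_meanZ -pattern_meanD.
    by apply: eq_pattern_mean => s; ring.
  rewrite ler_norml; apply/andP; split.
    rewrite -mulN1r -pattern_meanZ; apply: le_pattern_mean => s.
    rewrite mulN1r lerNl (le_trans _ (dist_mean_V _ n0))//.
    by rewrite -[leRHS]normrN ler_norm.
  by apply: le_pattern_mean => s; rewrite (le_trans _ (dist_mean_V _ n0))// ler_norm.
rewrite distrC (le_trans dist_V)//.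
have he : 13 * h = e by rewrite /h; field.
lra.
Unshelve. all: by end_near. Qed.

End MeanLimits.

(** * Almost sure convergence from summable expectations *)

Section AlmostSure.
Context d (T : measurableType d) (R : realType) (P : probability T R).

(** The series of the [f k] has a finite integral, so it is almost surely finite and its terms tend
    to 0. *)
Lemma ae_cvg0 (f : nat -> T -> R) (C : R) :
  (forall k, measurable_fun setT (f k)) -> (forall k w, 0 <= f k w) ->
  (forall k, ('E_P[f k] <= (C * k.+1%:R ^- 2)%:E)%E) ->
  {ae P, forall w, f k w @[k --> \oo] --> 0}.
Proof.
move=> mf f0 fC.
have mfE k : measurable_fun setT (fun w => (f k w)%:E) by exact/measurable_EFinP.
have f0E k w : (0 <= (f k w)%:E)%E by rewrite lee_fin.
have C0 : 0 <= C.
  have := fC 0%N; rewrite expr1n invr1 mulr1 -lee_fin; apply: le_trans.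
  by apply: expectation_ge0 => w.
pose F w := (\sum_(0 <= k <oo) (f k w)%:E)%E.
have F0 w : (0 <= F w)%E by apply: nneseries_ge0.
have mF : measurable_fun setT F by apply: ge0_emeasurable_sum.
have intF : (\int[P]_w F w <= (2 * C)%:E)%E.
  rewrite /F integral_nneseries//; apply: lime_le.
    by apply: is_cvg_nneseries => k _ _; apply: integral_ge0.
  apply: nearW => n; rewrite big_mkord.
  apply: (@le_trans _ _ (\sum_(k < n) (C * k.+1%:R ^- 2)%:E)%E).
    by apply: lee_sum => k _; have := fC k; rewrite unlock.
  rewrite sumEFin lee_fin -mulr_sumr mulrC ler_wpM2r//; exact: sum_inv_sqr.
have /integrable_ae : P.-integrable setT F.
  apply/integrableP; split => //.
  under eq_integral => w _ do rewrite gee0_abs//.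
  by rewrite (le_lt_trans intF)// ltry.
move=> /(_ measurableT); apply: filterS => w /(_ I) Ffin.
apply: cvg_series_cvg_0; apply: nondecreasing_is_cvgn.
  by apply/nondecreasing_seqP => n; rewrite /series/= big_nat_recr//= lerDl.
exists (fine (F w)) => _ [n _ <-]; rewrite -lee_fin fineK// /series/= -sumEFin.
by rewrite nneseries_lim_ge.
Qed.

End AlmostSure.

(** * From a subsequence to the whole sequence *)

Section Interpolation.
Context (R : realType).

(* V is squeezed between its neighbouring subsequence values because both its
   numerator and its denominator are nondecreasing. *)
Lemma cvg_ratio_interpolate (Q L : nat -> nat) (e : nat) (q : R) :
  {homo Q : m n / (m <= n)%N} -> {homo L : m n / (m <= n)%N} ->
  (forall n, (0 < n)%N -> (0 < L n)%N) -> (0 < e)%N ->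
  (Q (k.+1 ^ e)%N)%:R / (L (k.+1 ^ e)%N)%:R ^+ 2 @[k --> \oo] --> q ->
  (L (k.+2 ^ e)%N)%:R / (L (k.+1 ^ e)%N)%:R @[k --> \oo] --> (1 : R) ->
  (Q n)%:R / (L n)%:R ^+ 2 @[n --> \oo] --> q.
Proof.
move=> Qh Lh L0 e0 Vq rho1.
pose v k : R := (Q (k.+1 ^ e)%N)%:R / (L (k.+1 ^ e)%N)%:R ^+ 2.
pose rho k : R := (L (k.+2 ^ e)%N)%:R / (L (k.+1 ^ e)%N)%:R.
have Lk k : 0 < (L (k.+1 ^ e)%N)%:R :> R by rewrite ltr0n L0// expn_gt0.
have rho2 : rho k ^+ 2 @[k --> \oo] --> (1 : R).
  rewrite -[X in _ --> X]mulr1 (_ : (fun k => rho k ^+ 2) = (fun k => rho k * rho k)).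
    exact: cvgM.
  by apply/funext => k; rewrite expr2.
have lo : v k / rho k ^+ 2 @[k --> \oo] --> q.
  by rewrite -[X in _ --> X]divr1; apply: cvgM => //; apply: cvgV => //; exact: oner_neq0.
have hi : v k.+1 * rho k ^+ 2 @[k --> \oo] --> q.
  rewrite -[X in _ --> X]mulr1; apply: cvgM => //.
  by rewrite (cvg_shiftS v).
apply/cvgrPdist_le => /= eps eps0.
have /cvgrPdist_le /(_ _ eps0) [K1 _ lo1] := lo.
have /cvgrPdist_le /(_ _ eps0) [K2 _ hi2] := hi.
exists ((maxn K1 K2).+1 ^ e)%N => // n /= Kn.
(* The least admissible [k] with $n \le (k+2)^e$. Minimality gives $(k+1)^e \le n$, except when [k]
   equals [maxn K1 K2], where the bound on [n] does. *)
have [k [Kk kn nk]] : exists k,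
    [/\ (maxn K1 K2 <= k)%N, (k.+1 ^ e <= n)%N & (n <= k.+2 ^ e)%N].
  have ex_k : exists k, (maxn K1 K2 <= k)%N && (n <= k.+2 ^ e)%N.
    exists (maxn (maxn K1 K2) n); rewrite leq_maxl/=.
    apply: (@leq_trans (n ^ e)); last by rewrite leq_exp2r// leqW// leqW// leq_maxr.
    by rewrite -{1}(expn1 n) leq_pexp2l// (leq_trans _ Kn)// expn_gt0.
  exists (ex_minn ex_k); case: ex_minnP => k /andP[Kk nk] k_min; split => //.
  case: (ltngtP (maxn K1 K2) k) => [Klt|Kgt|<-//]; last by rewrite ltnNge Kk in Kgt.
  case: k Kk nk k_min Klt => // k _ _ k_min; rewrite ltnS => Kk.
  rewrite leqNgt; apply/negP => nk.
  by have := k_min k; rewrite Kk (ltnW nk) => /(_ isT); rewrite ltnn.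
have {lo1} := lo1 k (leq_trans (leq_maxl _ _) Kk).
have {hi2} := hi2 k (leq_trans (leq_maxr _ _) Kk).
have n0 : (0 < n)%N by rewrite (leq_trans _ kn)// expn_gt0.
have Ln : 0 < (L n)%:R :> R by rewrite ltr0n L0.
have vlo : v k / rho k ^+ 2 <= (Q n)%:R / (L n)%:R ^+ 2.
  rewrite (_ : v k / rho k ^+ 2 = (Q (k.+1 ^ e)%N)%:R / (L (k.+2 ^ e)%N)%:R ^+ 2); last first.
    by rewrite /v /rho; field; rewrite !lt0r_neq0.
  rewrite ler_pM ?invr_ge0 ?sqr_ge0 ?ler_nat ?Qh//.
  by rewrite lef_pV2 ?posrE ?exprn_gt0// lerXn2r ?nnegrE// ler_nat Lh.
have vhi : (Q n)%:R / (L n)%:R ^+ 2 <= v k.+1 * rho k ^+ 2.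
  rewrite (_ : v k.+1 * rho k ^+ 2 = (Q (k.+2 ^ e)%N)%:R / (L (k.+1 ^ e)%N)%:R ^+ 2); last first.
    by rewrite /v /rho; field; rewrite !lt0r_neq0.
  rewrite ler_pM ?invr_ge0 ?sqr_ge0 ?ler_nat ?Qh//.
  by rewrite lef_pV2 ?posrE ?exprn_gt0// lerXn2r ?nnegrE// ler_nat Lh.
rewrite !ler_norml => /andP[h1 h2] /andP[h3 h4]; apply/andP; split; lra.
Qed.

End Interpolation.

Lemma cvg_sqr_dist (R : realType) (u : nat -> R) (l : R) :
  (u k - l) ^+ 2 @[k --> \oo] --> 0 -> u k @[k --> \oo] --> l.
Proof.
move=> u2; apply/cvgrPdist_le => /= e e0.
have /cvgrPdist_le /(_ (e ^+ 2)) := u2; rewrite exprn_gt0// => /(_ isT).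
apply: filterS => k; rewrite sub0r normrN ger0_norm ?sqr_ge0//.
by rewrite distrC -[in X in _ -> X](@ler_pXn2r _ 2) ?nnegrE ?(ltW e0)// real_normK ?num_real.
Qed.

(** * Almost sure convergence of [V] *)

Section AlmostSureLimit.
Context (d : measure_display) (T : measurableType d) (R : realType)
  (P : probability T R) (X : nat -> {RV P >-> R}) (p : R).
Hypotheses (X_indep : mutually_independent X)
  (X_id : identically_distributed X)
  (X_cont : continuous_distribution (X 0%N))
  (p_gt : 2^-1 < p) (p_le : p <= 1).

Let path (w : T) : nat -> R := fun i => X i w.

Lemma ae_cvg_V : {ae P, forall w, V (path w) p n @[n --> \oo] --> qlim p}.
Proof.
have [pg pl] := conj p_gt p_le; set r := (2 * p - 1) / 4.
have r0 : 0 < r by rewrite divr_gt0//; lra.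
(* Along $(k+1)^e$ decay at rate [r] becomes at least as fast as $(k+1)^{-2}$, which is summable. *)
pose e := (Num.bound (2 / r)).+1.
have re : 2 <= r * e%:R.
  have b0 : 0 <= 2 / r by rewrite divr_ge0// ltW.
  rewrite mulrC -ler_pdivrMr// (le_trans (ltW (archi_boundP b0)))// ler_nat.
  exact: leqW.
pose m k := (k.+1 ^ e)%N.
have m0 k : (0 < m k)%N by rewrite expn_gt0.
have mS k : (m k <= m k.+1)%N by rewrite leq_exp2r.
have inv2 k : 0 <= k.+1%:R ^- 2 :> R by rewrite invr_ge0 sqr_ge0.
have [K K0 Kinv] := mean_inv_decay p_gt p_le.
have inv_le k : mean_inv p (m k) <= K * k.+1%:R ^- 2.
  by rewrite (le_trans (Kinv _ (m0 k)))// ler_wpM2l// decay_subseq.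
have ae_inv : {ae P, forall w,
    (nb_retained (path w) p (m k))%:R^-1 @[k --> \oo] --> (0 : R)}.
  have invI k : order_invariant (m k) (fun x => (nb_retained x p (m k))%:R^-1 : R).
    by move=> x y xy; rewrite (order_invariant_nb_retained p xy).
  apply: (ae_cvg0 (C := K)) => [k|k w|k].
  - exact: measurable_order_invariant (invI k).
  - by rewrite invr_ge0.
  - by rewrite (expectation_order_invariant X_indep X_id X_cont (invI k)) lee_fin inv_le.
have ae_growth : {ae P, forall w,
    (((nb_retained (path w) p (m k.+1))%:R - (nb_retained (path w) p (m k))%:R) /
     (nb_retained (path w) p (m k))%:R) ^+ 2 @[k --> \oo] --> (0 : R)}.
  pose g k x : R := (((nb_retained x p (m k.+1))%:R - (nb_retained x p (m k))%:R) /
     (nb_retained x p (m k))%:R) ^+ 2.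
  have gI k : order_invariant (m k.+1) (g k).
    move=> x y xy; rewrite /g (order_invariant_nb_retained p xy).
    by rewrite (order_invariant_nb_retained p (same_orderW (mS k) xy)).
  apply: (ae_cvg0 (C := 2 * (2 ^ e)%:R ^+ 2 + (2 ^ e)%:R * K)) => [k|k w|k].
  - exact: measurable_order_invariant (gI k).
  - exact: sqr_ge0.
  - rewrite (expectation_order_invariant X_indep X_id X_cont (gI k)) lee_fin.
    have := @mean_sqr_growth R p p_gt p_le (m k) (m k.+1) (m0 k) (mS k).
    rewrite -/(g k) /=; have := pow_step_ratio R e k; rewrite -/(m k) -/(m k.+1).
    set t := ((m k.+1)%:R - (m k)%:R) / _ => t_le g_le; apply: (le_trans g_le).
    have t0 : 0 <= t by rewrite divr_ge0// subr_ge0 ler_nat.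
    rewrite [leRHS]mulrDl; apply: lerD.
      rewrite -[leRHS]mulrA ler_wpM2l// -exprVn -exprMn.
      by rewrite lerXn2r ?nnegrE// divr_ge0.
    rewrite -[leRHS]mulrA ler_pM ?mean_inv_ge0//.
    by rewrite (le_trans t_le)// ler_piMr// invf_le1// ler1n.
(* All [N] are treated at once because the time at which the level is reached depends on [w]. The
   value 0 concerns finitely many [k], those for which time [N.+1] is not yet past. *)
have ae_sqr : {ae P, forall w, forall N,
    (if (N.+1 <= m k)%N then
       (level p <= nb_retained (path w) p N.+1)%:R *
         (scaled_sum p (m k) (path w) - qlim p) ^+ 2
     else 0) @[k --> \oo] --> (0 : R)}.
  apply: ae_foralln => N.
  pose g k x : R := if (N.+1 <= m k)%N then (level p <= nb_retained x p N.+1)%:R *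
         (scaled_sum p (m k) x - qlim p) ^+ 2 else 0.
  have gI k : order_invariant (m k) (g k).
    move=> x y xy; rewrite /g; case: ifP => // Nm.
    by rewrite (order_invariant_scaled_sum p xy) (order_invariant_level p Nm xy).
  have [K1 K10 sqr_le] := mean_sqr_decay p_gt p_le (ltn0Sn N).
  apply: (ae_cvg0 (C := K1)) => [k|k w|k].
  - exact: measurable_order_invariant (gI k).
  - by rewrite -/(g k (path w)) /g; case: ifP => // _; rewrite mulr_ge0// sqr_ge0.
  - rewrite (expectation_order_invariant X_indep X_id X_cont (gI k)) lee_fin.
    rewrite /g; case: (boolP (N.+1 <= m k)%N) => [Nm|_]; last first.
      by rewrite pattern_mean_cst mulr_ge0.
    rewrite (le_trans (sqr_le _ Nm))// ler_wpM2l//.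
    exact: decay_subseq.
move: ae_sqr; apply: filterS3 ae_inv ae_growth => w inv0 growth0 sqr0.
set L := nb_retained (path w) p in inv0 growth0 sqr0 *.
have L0 n : (0 < n)%N -> (0 < L n)%N by exact: nb_retained_gt0.
(* On this path $1/L$ tends to 0, so the level is reached at some [m k0]; [ae_sqr] is then used with
   the predecessor of [m k0]. *)
have [k0 k0_level] : exists k0, (level p <= L (m k0))%N.
  have l0 : 0 < (level p)%:R^-1 :> R by rewrite invr_gt0 ltr0n.
  have /cvgrPdist_le /(_ _ l0) [k0 _ /(_ k0 (leqnn _))] := inv0.
  rewrite /= sub0r normrN ger0_norm ?invr_ge0// lef_pV2 ?posrE ?ltr0n ?L0// ler_nat.
  by exists k0.
have U_cvg : scaled_sum p (m k) (path w) @[k --> \oo] --> qlim p.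
  apply: cvg_sqr_dist; move: (sqr0 (m k0).-1); rewrite prednK//.
  apply: cvg_trans; apply: near_eq_cvg; near=> k.
  have k0k : (k0 <= k)%N by near: k; exact: nbhs_infty_ge.
  by rewrite leq_exp2r// ltnS k0k k0_level mul1r.
have V_cvg : V (path w) p (m k) @[k --> \oo] --> qlim p.
  apply/cvgrPdist_le => /= eps eps0.
  have sum_cvg : 3 * `|scaled_sum p (m k) (path w) - qlim p| +
      2 * qlim p * (L (m k))%:R^-1 @[k --> \oo] --> 0.
    rewrite -[X in _ --> X](_ : 3 * `|qlim p - qlim p| + 2 * qlim p * 0 = 0); last first.
      by rewrite subrr normr0 !mulr0 addr0.
    apply: cvgD; apply: cvgM => //; try exact: cvg_cst.
    by apply: cvg_norm; apply: cvgB => //; exact: cvg_cst.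
  have /cvgrPdist_le /(_ _ eps0) := sum_cvg; apply: filterS => k.
  rewrite sub0r normrN => S_le; rewrite distrC; apply: le_trans S_le.
  exact: le_trans (dist_mean_V p_gt _ (m0 k)) (ler_norm _).
(* The relative growth in [growth0] is exactly this ratio minus 1. *)
have ratio_cvg : (L (m k.+1))%:R / (L (m k))%:R @[k --> \oo] --> (1 : R).
  apply: cvg_sqr_dist; move: growth0; apply: cvg_trans; apply: near_eq_cvg.
  apply: nearW => k; congr (_ ^+ 2); field.
  by rewrite pnatr_eq0 -lt0n L0.
apply: (@cvg_ratio_interpolate R _ L e) => //.
- exact: sum_ranks_homo.
- exact: nb_retained_homo.
Unshelve. all: by end_near. Qed.

End AlmostSureLimit.

Theorem theorem5p3 (d : measure_display) (T : measurableType d) (R : realType)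
    (P : probability T R) (X : nat -> {RV P >-> R}) (p : R)
    (X_indep : mutually_independent X)
    (X_id : identically_distributed X)
    (X_cont : continuous_distribution (X 0%N))
    (p_gt : 2^-1 < p) (p_le : p <= 1) :
  {ae P, forall w, V (fun i => X i w) p n @[n --> \oo] --> qlim p} /\
  ('E_P[fun w => V (fun i => X i w) p n] @[n --> \oo] --> (qlim p)%:E)%E.
Proof.
split; first exact: ae_cvg_V.
(* As [V] sees only the order pattern, its expectation is a finite average. *)
have V_inv n : order_invariant n (fun x => V x p n).
  move=> x y xy; rewrite /V (order_invariant_sum_ranks p xy).
  by rewrite (order_invariant_nb_retained p xy).
under eq_fun do rewrite (expectation_order_invariant X_indep X_id X_cont (V_inv _)).
by apply: cvg_EFin; [exact: nearW|exact: cvg_mean_V].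
Qed.
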